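(* Let $N\in\mathbb N$, let $T$ be the heat-semigroup on the reduced discrete Heisenberg group algebra $\mathbb H^r_N$ and $S$ the heat-semigroup on $\mathbb R^{2N}/2\pi\mathbb Z^{2N}$. Then, for all $t\in\mathbb R_{>0}$, $T(t)$ is of trace class and $$\mathrm{Htr}_{\mathbb H^r_N}(t)=\operatorname{tr}T(t)=\operatorname{tr}S(t).$$ In particular, the $k$-th heat coefficient $A_k(\mathbb H^r_N)$ of $\mathbb H^r_N$ coincides with the $k$-th heat coefficient $A_k(\mathbb R^{2N}/2\pi\mathbb Z^{2N})$ of $\mathbb R^{2N}/2\pi\mathbb Z^{2N}$.
   Context: $\mathbb H^r_N$ is the C*-algebra obtained from the discrete Heisenberg group algebra by taking the twist $Z$ to be a complex number (of modulus one) instead of a generator: it is generated by $(P,Q)^\mu:=P^mQ^n$, $\mu=(m,n)\in\mathbb Z^{2N}$, where $P_j,Q_j$ ($1\le j\le N$) are unitaries with $P_iP_j=P_jP_i$, $Q_iQ_j=Q_jQ_i$, $P_iQ_j=Q_jP_i$ for $i\ne j$, and $P_iQ_i=ZQ_iP_i$. The Brownian motion generating functional is $L((P,Q)^\mu)=-\frac12\|\mu\|^2_{\ell_2(2N)}$; the Laplacian is twice the corresponding generator, and the heat-semigroup acts by $T(t)(P,Q)^\mu=e^{-t\|\mu\|^2_{\ell_2(2N)}}(P,Q)^\mu$. $S$ is the semigroup generated by the (non-positive) Laplacian on the flat torus $\mathbb R^{2N}/2\pi\mathbb Z^{2N}$. Traces on $\mathbb H^r_N$ are spectral: an operator $(P,Q)^\mu\mapsto\lambda_\mu(P,Q)^\mu$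 is of trace class if $(\lambda_\mu)_{\mu\in\mathbb Z^{2N}}$ is absolutely summable, with trace $\sum_\mu\lambda_\mu$. $\mathrm{Htr}_{\mathbb H^r_N}(t)$ denotes the heat-trace $\operatorname{tr}T(t)$. Heat coefficients $A_k$ are the coefficients in the asymptotic expansion, as $t\searrow0$, of the heat-trace in the form $(4\pi t)^{-N}\sum_{k\in\mathbb N_0}A_kt^{k/2}$. *)

(* Defs.v *)
From HB Require Import structures.
From mathcomp Require Import all_boot all_order all_algebra.
From mathcomp Require Import all_classical all_reals all_analysis.
From mathcomp Require Import complex.
Set Implicit Arguments.
Unset Strict Implicit.
Unset Printing Implicit Defensive.
Import Order.TTheory GRing.Theory Num.Theory.
Import numFieldNormedType.Exports.
Local Open Scope classical_set_scope.
Local Open Scope ring_scope.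

(** * Absolutely summable families of complex numbers *)

Section complex_sums.
Variables (R : realType) (I : choiceType).
Implicit Type f : I -> R[i].

Definition abs_summable f : Prop :=
  summable [set: I] (fun i => (Normc.normc (f i))%:E).

Let rsum (a : I -> R) : R :=
  fine (\esum_(i in [set: I]) (EFin \o a)^\+%E i) -
  fine (\esum_(i in [set: I]) (EFin \o a)^\-%E i).

(* [\esum] is only meaningful for nonnegative terms, hence the splitting into
   positive and negative parts.  Meaningful for [abs_summable] families. *)
Definition csum f : R[i] :=
  Complex (rsum (fun i => complex.Re (f i))) (rsum (fun i => complex.Im (f i))).

End complex_sums.

(** * Unital C*-algebras *)

Record cstarAlgebra (R : realType) := CStarAlgebra {
  cs_carrier :> completeNormedModType R[i] ;
  cs_mul : cs_carrier -> cs_carrier -> cs_carrier ;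
  cs_one : cs_carrier ;
  cs_star : cs_carrier -> cs_carrier ;
  cs_mulA : associative cs_mul ;
  cs_mul1x : left_id cs_one cs_mul ;
  cs_mulx1 : right_id cs_one cs_mul ;
  cs_mulDl : left_distributive cs_mul +%R ;
  cs_mulDr : right_distributive cs_mul +%R ;
  cs_scaleAl : forall (c : R[i]) x y, c *: cs_mul x y = cs_mul (c *: x) y ;
  cs_scaleAr : forall (c : R[i]) x y, c *: cs_mul x y = cs_mul x (c *: y) ;
  cs_one_neq0 : cs_one != 0 ;
  cs_starK : involutive cs_star ;
  cs_starD : {morph cs_star : x y / x + y} ;
  cs_starZ : forall (c : R[i]) x, cs_star (c *: x) = conjc c *: cs_star x ;
  cs_starM : forall x y, cs_star (cs_mul x y) = cs_mul (cs_star y) (cs_star x) ;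
  cs_normM : forall x y, `|cs_mul x y| <= `|x| * `|y| ;
  cs_normE : forall x, `|cs_mul (cs_star x) x| = `|x| ^+ 2 }.

Arguments cs_one {R A} : rename.
Arguments cs_mul {R A} : rename.
Arguments cs_star {R A} : rename.

Section cstar_theory.
Variable R : realType.
Implicit Types A B : cstarAlgebra R.

Definition unitary A (u : A) : Prop :=
  cs_mul (cs_star u) u = cs_one /\ cs_mul u (cs_star u) = cs_one.

(* Integer power of a unitary, whose inverse is its adjoint. *)
Definition upow A (u : A) (m : int) : A :=
  match m with
  | Posz k => iter k (cs_mul u) cs_one
  | Negz k => iter k.+1 (cs_mul (cs_star u)) cs_one
  end.

Definition star_morphism A B (phi : {linear A -> B}) : Prop :=
  [/\ phi cs_one = cs_one,
      forall x y, phi (cs_mul x y) = cs_mul (phi x) (phi y) &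
      forall x, phi (cs_star x) = cs_star (phi x)].

End cstar_theory.

(** * The reduced discrete Heisenberg group algebra *)

Section heisenberg.
Variables (R : realType) (N : nat) (Z : R[i]).
Implicit Types A H : cstarAlgebra R.

Record heisenberg_relations A (P Q : 'I_N -> A) : Prop := {
  heis_unitaryP : forall j, unitary (P j) ;
  heis_unitaryQ : forall j, unitary (Q j) ;
  heis_PP : forall i j, cs_mul (P i) (P j) = cs_mul (P j) (P i) ;
  heis_QQ : forall i j, cs_mul (Q i) (Q j) = cs_mul (Q j) (Q i) ;
  heis_PQ : forall i j, i != j -> cs_mul (P i) (Q j) = cs_mul (Q j) (P i) ;
  heis_PQZ : forall i, cs_mul (P i) (Q i) = Z *: cs_mul (Q i) (P i) }.

(* The multi-index mu = (m, n) in Z^{2N} is the row vector [row_mx m n]. *)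
Definition heis_monomial A (P Q : 'I_N -> A) (mu : 'rV[int]_(N + N)) : A :=
  cs_mul (\big[cs_mul/cs_one]_(j < N) upow (P j) (mu 0 (lshift N j)))
         (\big[cs_mul/cs_one]_(j < N) upow (Q j) (mu 0 (rshift N j))).

Definition heis_span A (P Q : 'I_N -> A) : set A :=
  [set x | exists (s : seq 'rV[int]_(N + N)) (c : 'rV[int]_(N + N) -> R[i]),
     x = \sum_(mu <- s) c mu *: heis_monomial P Q mu].

(* H is the C*-algebra generated by P_j, Q_j subject to the Heisenberg
   relations with central element specialized to Z: it is generated by them as
   a C*-algebra, and any other realization of the relations factors through it
   (so that no further relation is imposed). *)
Record is_heisenberg H (P Q : 'I_N -> H) : Prop := {
  heis_rel : heisenberg_relations P Q ;
  heis_generated : closure (heis_span P Q) = [set: H] ;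
  heis_universal : forall (B : cstarAlgebra R) (P' Q' : 'I_N -> B),
    heisenberg_relations P' Q' ->
    exists phi : {linear H -> B}, star_morphism phi /\
      (forall j, phi (P j) = P' j /\ phi (Q j) = Q' j) }.

Definition normsq (n : nat) (mu : 'rV[int]_n) : R :=
  \sum_(i < n) (mu 0 i)%:~R ^+ 2.

Definition is_heis_heat_semigroup H (P Q : 'I_N -> H)
    (T : R -> {linear H -> H}) : Prop :=
  forall t, 0 <= t -> continuous (T t) /\
    forall mu, T t (heis_monomial P Q mu) =
      (expR (- t * normsq mu))%:C%C *: heis_monomial P Q mu.

Definition has_spectral_trace H (P Q : 'I_N -> H)
    (F : H -> H) (tau : R[i]) : Prop :=
  exists lambda : 'rV[int]_(N + N) -> R[i],
    [/\ forall mu, F (heis_monomial P Q mu) = lambda mu *: heis_monomial P Q mu,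
        abs_summable lambda & csum lambda = tau].

Definition spectral_trace_class H (P Q : 'I_N -> H)
  (F : H -> H) : Prop := exists tau, has_spectral_trace P Q F tau.

Definition spectral_trace H (P Q : 'I_N -> H)
  (F : H -> H) : R[i] := xget 0 [set tau | has_spectral_trace P Q F tau].

Definition heis_heat_trace H (P Q : 'I_N -> H)
  (T : R -> {linear H -> H}) (t : R) : R[i] := spectral_trace P Q (T t).

End heisenberg.

(** * The flat torus R^n / 2 pi Z^n *)

Section torus_measure.
Variable R : realType.

Let m02pi : measurable (`[0, 2 * pi[%classic : set (measurableTypeR R)).
Proof. exact: measurable_itv. Qed.

Let fin02pi : (@lebesgue_measure R `[0%R, (2 * pi)%R[%classic < +oo)%E.
Proof. by rewrite lebesgue_measure_itv; case: ifP => _ //=; rewrite ltry. Qed.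

Definition circle_measure : {finite_measure set (measurableTypeR R) -> \bar R} :=
  mfrestr m02pi fin02pi.

Section step.
Variables (n : nat)
  (mu : {finite_measure set (n.-tuple (measurableTypeR R)) -> \bar R}).

Definition prependT (p : measurableTypeR R * n.-tuple (measurableTypeR R)) :
  n.+1.-tuple (measurableTypeR R) := [the n.+1.-tuple _ of p.1 :: p.2].

Lemma measurable_prependT : measurable_fun [set: _] prependT.
Proof.
by apply: measurable_cons; [exact: measurable_fst|exact: measurable_snd].
Qed.

Definition torus_step : set (n.+1.-tuple (measurableTypeR R)) -> \bar R :=
  pushforward (circle_measure \x mu)%E prependT.

Let circle_prod : {measure set (measurableTypeR R *
  n.-tuple (measurableTypeR R)) -> \bar R} := (circle_measure \x mu)%E.

HB.instance Definition _ := Measure.copy torus_step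
  (measure_function_pushforward__canonical__measure_function_Measure
     circle_prod measurable_prependT).

Let torus_step_finite : fin_num_fun torus_step.
Proof.
have h : ((circle_measure \x mu) setT < +oo)%E.
  rewrite -setXTT product_measure1E//.
  by rewrite lte_mul_pinfty// ?fin_num_measure// ltey_eq fin_num_measure.
by apply: lty_fin_num_fun; exact: h.
Qed.

HB.instance Definition _ :=
  Measure_isFinite.Build _ _ _ torus_step torus_step_finite.

End step.

(* Lebesgue measure on the fundamental domain [0, 2 pi[^n. *)
Fixpoint torus_measure (n : nat) :
    {finite_measure set (n.-tuple (measurableTypeR R)) -> \bar R} :=
  match n with
  | 0%N => dirac [tuple]
  | n'.+1 => torus_step (torus_measure n')
  end.

End torus_measure.

(* Functions on the torus are represented by their values on [0, 2 pi[^n, and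
   elements of L^2 by functions, identified when equal almost everywhere. *)
Section torus_L2.
Variables (R : realType) (n : nat).
Local Notation X := (n.-tuple (measurableTypeR R)).
Local Notation mu := (@torus_measure R n).
Implicit Types f g : X -> R[i].

Definition torus_L2 f : Prop :=
  [/\ measurable_fun [set: X] (fun x => complex.Re (f x) : measurableTypeR R),
      measurable_fun [set: X] (fun x => complex.Im (f x) : measurableTypeR R) &
      (\int[mu]_x ((Normc.normc (f x)) ^+ 2)%:E < +oo)%E].

Definition L2inner f g : R[i] :=
  Complex (\int[mu]_x complex.Re (f x * conjc (g x)))
          (\int[mu]_x complex.Im (f x * conjc (g x))).

Definition L2norm f : R :=
  Num.sqrt (\int[mu]_x ((Normc.normc (f x)) ^+ 2)).

Definition L2eq f g : Prop := {ae mu, forall x, f x = g x}.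

(* The torus has infinite-dimensional separable L^2 (when n > 0), so Hilbert
   bases are indexed by nat. *)
Definition hilbert_basis (b : nat -> X -> R[i]) : Prop :=
  [/\ forall i, torus_L2 (b i),
      forall i j, L2inner (b i) (b j) = (i == j)%:R &
      forall f, torus_L2 f -> forall e : R, 0 < e ->
        exists m (c : nat -> R[i]),
          L2norm (fun x => f x - \sum_(i < m) c i * b i x) < e].

(* A bounded operator F on a complex Hilbert space is of trace class if and only
   if the diagonal (<F b_i, b_i>)_i is absolutely summable for every Hilbert
   basis b; the sum is then the same for all b, and it is the trace of F. *)
Definition has_L2_trace (F : (X -> R[i]) -> X -> R[i]) (tau : R[i]) : Prop :=
  forall b, hilbert_basis b ->
    abs_summable (fun i => L2inner (F (b i)) (b i)) /\
    csum (fun i => L2inner (F (b i)) (b i)) = tau.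

Definition L2_trace_class (F : (X -> R[i]) -> X -> R[i]) : Prop :=
  exists tau, has_L2_trace F tau.

Definition L2_trace (F : (X -> R[i]) -> X -> R[i]) : R[i] :=
  xget 0 [set tau | has_L2_trace F tau].

(** ** Strongly continuous semigroups on L^2 and their generators *)

(* The exponential bound in [C0_bounded] is automatic for strongly continuous
   semigroups of bounded operators on a Banach space. *)
Record C0_semigroup (S : R -> (X -> R[i]) -> X -> R[i]) : Prop := {
  C0_L2 : forall t f, 0 <= t -> torus_L2 f -> torus_L2 (S t f) ;
  C0_linear : forall t (a : R[i]) f g, 0 <= t -> torus_L2 f -> torus_L2 g ->
    L2eq (S t (fun x => a * f x + g x)) (fun x => a * S t f x + S t g x) ;
  C0_bounded : exists M w : R, forall t f, 0 <= t -> torus_L2 f ->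
    L2norm (S t f) <= M * expR (w * t) * L2norm f ;
  C0_zero : forall f, torus_L2 f -> L2eq (S 0 f) f ;
  C0_add : forall s t f, 0 <= s -> 0 <= t -> torus_L2 f ->
    L2eq (S (s + t) f) (S s (S t f)) ;
  C0_continuous : forall f, torus_L2 f ->
    L2norm (fun x => S h f x - f x) @[h --> 0^'+] --> (0 : R) }.

(* f is in the domain of the generator of S, which maps it to g. *)
Definition generator (S : R -> (X -> R[i]) -> X -> R[i]) f g : Prop :=
  [/\ torus_L2 f, torus_L2 g &
      L2norm (fun x => (h^-1)%:C%C * (S h f x - f x) - g x) @[h --> 0^'+]
        --> (0 : R)].

(** ** The Laplacian *)

Definition partial (i : 'I_n) (u : 'rV[R]_n -> R) : 'rV[R]_n -> R :=
  fun x => 'D_(delta_mx 0 i) u x.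

Fixpoint Ck (k : nat) (u : 'rV[R]_n -> R) : Prop :=
  match k with
  | 0%N => continuous u
  | k'.+1 => continuous u /\ forall i,
      (forall x, derivable u x (delta_mx 0 i)) /\ Ck k' (partial i u)
  end.

Definition laplacian (u : 'rV[R]_n -> R[i]) : 'rV[R]_n -> R[i] :=
  fun x => Complex
    (\sum_(i < n) partial i (partial i (fun y => complex.Re (u y))) x)
    (\sum_(i < n) partial i (partial i (fun y => complex.Im (u y))) x).

(* Smooth functions on the torus, as 2 pi-periodic smooth functions on R^n. *)
Definition torus_smooth (u : 'rV[R]_n -> R[i]) : Prop :=
  [/\ forall k, Ck k (fun x => complex.Re (u x)),
      forall k, Ck k (fun x => complex.Im (u x)) &
      forall i x, u (x + (2 * pi) *: delta_mx 0 i) = u x].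

Definition on_torus (u : 'rV[R]_n -> R[i]) : X -> R[i] :=
  fun x => u (\row_(i < n) tnth x i).

(* Graph of the L^2-closure of the Laplacian on smooth functions, that is, of
   the (non-positive, self-adjoint) Laplacian of the torus. *)
Definition torus_laplacian f g : Prop :=
  [/\ torus_L2 f, torus_L2 g &
      exists u : nat -> 'rV[R]_n -> R[i],
        [/\ forall k, torus_smooth (u k),
            L2norm (fun x => on_torus (u k) x - f x) @[k --> \oo] --> (0 : R) &
            L2norm (fun x => on_torus (laplacian (u k)) x - g x) @[k --> \oo]
              --> (0 : R)]].

Definition is_torus_heat_semigroup (S : R -> (X -> R[i]) -> X -> R[i]) : Prop :=
  C0_semigroup S /\ forall f g, generator S f g <-> torus_laplacian f g.

Definition torus_heat_trace (S : R -> (X -> R[i]) -> X -> R[i]) (t : R) : R[i] :=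
  L2_trace (S t).

End torus_L2.

(** * Heat coefficients *)

(* h has the asymptotic expansion (4 pi t)^{-N} \sum_k A_k t^{k/2} as t -> 0+:
   for all K, (4 pi t)^N h(t) = \sum_{k <= K} A_k t^{k/2} + o(t^{K/2}). *)
Definition heat_coefficients (R : realType) (N : nat) (h : R -> R[i])
    (A : nat -> R[i]) : Prop :=
  forall K : nat,
    Normc.normc (((4 * pi * t) ^+ N)%:C%C * h t -
                 \sum_(k < K.+1) A k * (Num.sqrt t ^+ k)%:C%C)
      / Num.sqrt t ^+ K @[t --> 0^'+] --> (0 : R).

(* Main.v *)
(** Every monomial of the Heisenberg algebra is unitary, hence nonzero, so the
    eigenvalues exp(-t|mu|^2) of T(t) are determined and the trace of T(t) is the
    Gaussian sum of exp(-t|mu|^2) over mu in Z^(2N).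

    On the torus the character e_mu is an eigenfunction of the Laplacian with
    eigenvalue -|mu|^2.  As the generator of S is the Laplacian, S(h) e_mu and
    exp(-h|mu|^2) e_mu agree up to o(h); telescoping over m steps of length t/m
    gives S(t) e_mu = exp(-t|mu|^2) e_mu.  The characters form a Hilbert basis:
    indicators of the sets {g < c}, with g a real trigonometric polynomial, are
    bounded pointwise limits of trigonometric polynomials, these sets generate
    the Borel sets of the torus, and a pi-lambda argument followed by dominated
    convergence reaches all of L^2.  For an arbitrary Hilbert basis (b_i) one then
    has <S(t) b_i, b_i> = sum_mu exp(-t|mu|^2) |<b_i, e_mu>|^2, a sum of
    nonnegative terms; exchanging the sums over i and mu and applying Parseval to
    each e_mu gives the same Gaussian sum.  Equal heat traces have equal
    asymptotic expansions, and the coefficients of an expansion are unique. *)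

Require Import Defs.
From mathcomp Require Import all_boot all_order all_algebra.
From mathcomp Require Import all_classical all_reals all_analysis.
From mathcomp Require Import measurable_realfun complex ring lra.
Set Implicit Arguments.
Unset Strict Implicit.
Unset Printing Implicit Defensive.
Import Order.TTheory GRing.Theory Num.Theory.
Import numFieldNormedType.Exports.
Local Open Scope classical_set_scope.
Local Open Scope ring_scope.

(** * Real parts, imaginary parts and moduli of complex numbers *)

Section complex_extra.
Variable R : realType.
Implicit Types z w : R[i].

Lemma sqr_normcE z : Normc.normc z ^+ 2 = complex.Re z ^+ 2 + complex.Im z ^+ 2.
Proof. by case: z => a b /=; rewrite sqr_sqrtr// addr_ge0 ?sqr_ge0. Qed.

Lemma normc_ge0 z : 0 <= Normc.normc z.
Proof. by case: z => a b /=; rewrite sqrtr_ge0. Qed.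

Lemma mulc_conjE z : z * conjc z = (Normc.normc z ^+ 2)%:C%C.
Proof. by rewrite sqr_normcE; case: z => a b /=; simpc; congr Complex; ring. Qed.

Lemma complexReD z w : complex.Re (z + w) = complex.Re z + complex.Re w.
Proof. by case: z w => [a b] [c d]. Qed.

Lemma complexImD z w : complex.Im (z + w) = complex.Im z + complex.Im w.
Proof. by case: z w => [a b] [c d]. Qed.

Lemma complexReM z w : complex.Re (z * w) =
  complex.Re z * complex.Re w - complex.Im z * complex.Im w.
Proof. by case: z w => [a b] [c d]. Qed.

Lemma complexImM z w : complex.Im (z * w) =
  complex.Re z * complex.Im w + complex.Im z * complex.Re w.
Proof. by case: z w => [a b] [c d]. Qed.

Lemma Re_conjc z : complex.Re (conjc z) = complex.Re z.
Proof. by case: z. Qed.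

Lemma Im_conjc z : complex.Im (conjc z) = - complex.Im z.
Proof. by case: z. Qed.

Lemma conjD z w : conjc (z + w) = conjc z + conjc w.
Proof. exact: rmorphD. Qed.

Lemma conjM z w : conjc (z * w) = conjc z * conjc w.
Proof. exact: rmorphM. Qed.

Lemma conj_sum (I : Type) (r : seq I) (P : pred I) (F : I -> R[i]) :
  conjc (\sum_(i <- r | P i) F i) = \sum_(i <- r | P i) conjc (F i).
Proof. exact: rmorph_sum. Qed.

Lemma Re_le_normc z : complex.Re z <= Normc.normc z.
Proof.
rewrite (le_trans (ler_norm _))// -sqrtr_sqr; case: z => a b /=.
by apply: ler_wsqrtr; rewrite lerDl sqr_ge0.
Qed.

Lemma normc_opp z : Normc.normc (- z) = Normc.normc z.
Proof. by case: z => a b /=; rewrite !sqrrN. Qed.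

Lemma normc0E : Normc.normc (0 : R[i]) = 0.
Proof. exact: Normc.normc0. Qed.

End complex_extra.


(** * Integrability of real-valued linear combinations *)

Section real_integrable.
Context d (T : measurableType d) (R : realType) (mu : {measure set T -> \bar R}).
Implicit Types f g : T -> R.

Lemma integrable_RZ (r : R) f : mu.-integrable setT (EFin \o f) ->
  mu.-integrable setT (EFin \o (fun x => r * f x)).
Proof.
by move=> fi; apply: eq_integrable (integrableZl measurableT r fi).
Qed.

Lemma integrable_RD f g : mu.-integrable setT (EFin \o f) ->
  mu.-integrable setT (EFin \o g) ->
  mu.-integrable setT (EFin \o (fun x => f x + g x)).
Proof.
by move=> fi gi; apply: eq_integrable (integrableD measurableT fi gi).
Qed.

Lemma integrable_RB f g : mu.-integrable setT (EFin \o f) ->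
  mu.-integrable setT (EFin \o g) ->
  mu.-integrable setT (EFin \o (fun x => f x - g x)).
Proof.
by move=> fi gi; apply: eq_integrable (integrableB measurableT fi gi).
Qed.

End real_integrable.

(** * The Hilbert space L^2 of the torus *)

Section L2.
Variables (R : realType) (n : nat).
Local Notation X := (n.-tuple (measurableTypeR R)).
Local Notation mu := (@torus_measure R n).
Implicit Types f g h : X -> R[i].
Implicit Types a c : R[i].

Definition nsq f : R := (\int[mu]_x (Normc.normc (f x) ^+ 2))%R.

Lemma L2_measurable_nsq f : torus_L2 f ->
  measurable_fun [set: X] (fun x => Normc.normc (f x) ^+ 2).
Proof.
case=> mR mI _; under eq_fun do rewrite sqr_normcE.
by apply: measurable_funD; exact: measurable_funX.
Qed.

Lemma L2_integrable f : torus_L2 f ->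
  mu.-integrable [set: X] (EFin \o (fun x => Normc.normc (f x) ^+ 2)).
Proof.
move=> Lf; apply/integrableP; split.
  by apply/measurable_EFinP; exact: L2_measurable_nsq.
case: Lf => _ _; apply: le_lt_trans; rewrite le_eqVlt; apply/orP; left; apply/eqP.
by apply: eq_integral => x _ /=; rewrite ger0_norm ?sqr_ge0.
Qed.

Lemma L2_dom f (G : X -> R) :
  measurable_fun [set: X] (fun x => complex.Re (f x)) ->
  measurable_fun [set: X] (fun x => complex.Im (f x)) ->
  mu.-integrable [set: X] (EFin \o G) ->
  (forall x, Normc.normc (f x) ^+ 2 <= G x) -> torus_L2 f.
Proof.
move=> mR mI /integrableP[mG iG] fG; split => //.
apply: le_lt_trans iG; apply: ge0_le_integral => //=.
- by move=> x _; rewrite lee_fin sqr_ge0.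
- apply/measurable_EFinP; under eq_fun do rewrite sqr_normcE.
  by apply: measurable_funD; exact: measurable_funX.
- by apply: measurableT_comp => //; apply: measurableT_comp => //; exact/measurable_EFinP.
- by move=> x _; rewrite lee_fin (le_trans (fG x))// ler_norm.
Qed.

(** Parallelogram identity: the two sides differ by |az - w|^2. *)
Lemma normc_lin_bound a (z w : R[i]) : Normc.normc (a * z + w) ^+ 2 <=
  2 * Normc.normc a ^+ 2 * Normc.normc z ^+ 2 + 2 * Normc.normc w ^+ 2.
Proof.
rewrite -mulrA -exprMn -Normc.normcM; move: (a * z) => {}z.
rewrite !sqr_normcE complexReD complexImD.
move: (complex.Re z) (complex.Im z) (complex.Re w) (complex.Im w) => p q r s.
rewrite -subr_ge0.
rewrite [X in 0 <= X](_ : _ = (p - r) ^+ 2 + (q - s) ^+ 2); last by ring.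
by rewrite addr_ge0 ?sqr_ge0.
Qed.

Lemma L2_lin a f g : torus_L2 f -> torus_L2 g ->
  torus_L2 (fun x => a * f x + g x).
Proof.
move=> Lf Lg; have [mRf mIf _] := Lf; have [mRg mIg _] := Lg.
apply: (@L2_dom _ (fun x => 2 * Normc.normc a ^+ 2 * Normc.normc (f x) ^+ 2 +
    2 * Normc.normc (g x) ^+ 2)).
- under eq_fun do rewrite complexReD complexReM.
  by apply: measurable_funD => //; apply: measurable_funB;
    apply: measurable_funM.
- under eq_fun do rewrite complexImD complexImM.
  by apply: measurable_funD => //; apply: measurable_funD;
    apply: measurable_funM.
- apply: eq_integrable (integrableD measurableT
    (integrableZl measurableT (2 * Normc.normc a ^+ 2) (L2_integrable Lf))
    (integrableZl measurableT 2 (L2_integrable Lg))) => //.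
- by move=> x; exact: normc_lin_bound.
Qed.

Lemma L2_0 : torus_L2 (fun _ : X => 0 : R[i]).
Proof.
apply: (@L2_dom _ (fun=> 0)) => //; first exact: integrable0.
by move=> x; rewrite (normc0E R) expr0n.
Qed.

Lemma L2_Z a f : torus_L2 f -> torus_L2 (fun x => a * f x).
Proof.
move=> Lf; have := L2_lin a Lf L2_0.
by under eq_fun do rewrite addr0.
Qed.

Lemma L2_D f g : torus_L2 f -> torus_L2 g -> torus_L2 (fun x => f x + g x).
Proof.
move=> Lf Lg; have := L2_lin 1 Lf Lg.
by under eq_fun do rewrite mul1r.
Qed.

Lemma L2_B f g : torus_L2 f -> torus_L2 g -> torus_L2 (fun x => f x - g x).
Proof.
move=> Lf Lg; have := L2_lin (-1) Lg Lf.
by under eq_fun do rewrite mulN1r addrC.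
Qed.

Lemma L2_sum (F : nat -> X -> R[i]) m : (forall i, torus_L2 (F i)) ->
  torus_L2 (fun x => \sum_(i < m) F i x).
Proof.
move=> LF; elim: m => [|m IH].
  by under eq_fun do rewrite big_ord0; exact: L2_0.
by under eq_fun do rewrite big_ord_recr; exact: L2_D.
Qed.

(** Both parts are dominated by |f|^2 + |g|^2, since 2|pq| <= p^2 + q^2 for each product of
    coordinates; the squares of sums and differences given to [nra] encode exactly this. *)
Lemma L2_int f g : torus_L2 f -> torus_L2 g ->
  mu.-integrable [set: X] (EFin \o (fun x => complex.Re (f x * conjc (g x)))) /\
  mu.-integrable [set: X] (EFin \o (fun x => complex.Im (f x * conjc (g x)))).
Proof.
move=> Lf Lg; have [mRf mIf _] := Lf; have [mRg mIg _] := Lg.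
have iG := integrableD measurableT (L2_integrable Lf) (L2_integrable Lg).
split.
- apply: (le_integrable measurableT _ _ iG).
    apply/measurable_EFinP; under eq_fun do rewrite complexReM Re_conjc Im_conjc mulrN opprK.
    by apply: measurable_funD; apply: measurable_funM.
  move=> x _ /=; rewrite lee_fin [leRHS]ger0_norm ?addr_ge0 ?sqr_ge0//.
  rewrite !sqr_normcE complexReM Re_conjc Im_conjc.
  move: (complex.Re (f x)) (complex.Im (f x)) (complex.Re (g x)) (complex.Im (g x)).
  by move=> p q r s; rewrite ler_norml; apply/andP;
  by move: (sqr_ge0 (p + r)) (sqr_ge0 (q + s)) (sqr_ge0 (p - r)) (sqr_ge0 (q - s))
    (sqr_ge0 (p + s)) (sqr_ge0 (q + r)) (sqr_ge0 (p - s)) (sqr_ge0 (q - r)) => *; split; nra.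
- apply: (le_integrable measurableT _ _ iG).
    apply/measurable_EFinP; under eq_fun do rewrite complexImM Re_conjc Im_conjc mulrN.
    apply: measurable_funD; last by apply: measurable_funM.
    by apply: measurable_funN; apply: measurable_funM.
  move=> x _ /=; rewrite lee_fin [leRHS]ger0_norm ?addr_ge0 ?sqr_ge0//.
  rewrite !sqr_normcE complexImM Re_conjc Im_conjc.
  move: (complex.Re (f x)) (complex.Im (f x)) (complex.Re (g x)) (complex.Im (g x)).
  by move=> p q r s; rewrite ler_norml; apply/andP;
  by move: (sqr_ge0 (p + r)) (sqr_ge0 (q + s)) (sqr_ge0 (p - r)) (sqr_ge0 (q - s))
    (sqr_ge0 (p + s)) (sqr_ge0 (q + r)) (sqr_ge0 (p - s)) (sqr_ge0 (q - r)) => *; split; nra.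
Qed.

Local Notation ip := (@L2inner R n).

Lemma ip_lin a f g h : torus_L2 f -> torus_L2 g -> torus_L2 h ->
  ip (fun x => a * f x + g x) h = a * ip f h + ip g h.
Proof.
move=> Lf Lg Lh; have [iRf iIf] := L2_int Lf Lh; have [iRg iIg] := L2_int Lg Lh.
rewrite /L2inner; apply/eqP;
  rewrite eq_complex complexReD complexImD complexReM complexImM /=;
  apply/andP; split; apply/eqP.
- rewrite -!RintegralZl// -RintegralB//; try exact: integrable_RZ.
  rewrite -RintegralD//.
    by apply: eq_Rintegral => x _; rewrite mulrDl -mulrA complexReD complexReM.
  by apply: integrable_RB; exact: integrable_RZ.
- rewrite -!RintegralZl// -RintegralD//; try exact: integrable_RZ.
  rewrite -RintegralD//.
    by apply: eq_Rintegral => x _; rewrite mulrDl -mulrA complexImD complexImM.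
  by apply: integrable_RD; exact: integrable_RZ.
Qed.

Lemma ip_conj f g : torus_L2 f -> torus_L2 g -> ip g f = conjc (ip f g).
Proof.
move=> Lf Lg; have [iR iI] := L2_int Lf Lg.
rewrite /L2inner /=; congr Complex.
  by apply: eq_Rintegral => x _; rewrite !complexReM !Re_conjc !Im_conjc; ring.
rewrite -[RHS]mulN1r -RintegralZl//.
by apply: eq_Rintegral => x _; rewrite !complexImM !Re_conjc !Im_conjc; ring.
Qed.

Lemma ip_nsq f : ip f f = (nsq f)%:C%C.
Proof.
rewrite /L2inner /nsq; congr Complex.
  by apply: eq_Rintegral => x _; rewrite mulc_conjE.
rewrite -(mul0r (fine (mu setT))) -Rintegral_cst//.
by apply: eq_Rintegral => x _; rewrite mulc_conjE.
Qed.

Lemma nsq_ge0 f : 0 <= nsq f.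
Proof. by apply: Rintegral_ge0 => x _; rewrite sqr_ge0. Qed.

Lemma L2normE f : L2norm f = Num.sqrt (nsq f).
Proof. by []. Qed.

Lemma L2norm_ge0 f : 0 <= L2norm f.
Proof. exact: sqrtr_ge0. Qed.

Lemma L2norm_sqr f : L2norm f ^+ 2 = nsq f.
Proof. by rewrite L2normE sqr_sqrtr ?nsq_ge0. Qed.

Lemma ip0l h : ip (fun _ => 0) h = 0.
Proof.
have I0 : \int[mu]_x 0 = 0 :> R by rewrite Rintegral_cst// mul0r.
rewrite /L2inner; congr Complex; rewrite -[RHS]I0; apply: eq_Rintegral => x _;
  by rewrite mul0r.
Qed.

Lemma ipZl a f h : torus_L2 f -> torus_L2 h -> ip (fun x => a * f x) h = a * ip f h.
Proof.
move=> Lf Lh; rewrite -[RHS]addr0 -(ip0l h) -ip_lin//; last exact: L2_0.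
by under [X in _ = ip X _]eq_fun do rewrite addr0.
Qed.

Lemma ipDl f g h : torus_L2 f -> torus_L2 g -> torus_L2 h ->
  ip (fun x => f x + g x) h = ip f h + ip g h.
Proof.
move=> Lf Lg Lh; rewrite -[ip f h]mul1r -ip_lin//.
by under [X in _ = ip X _]eq_fun do rewrite mul1r.
Qed.

Lemma ipBl f g h : torus_L2 f -> torus_L2 g -> torus_L2 h ->
  ip (fun x => f x - g x) h = ip f h - ip g h.
Proof.
move=> Lf Lg Lh; rewrite addrC -mulN1r -ip_lin//.
by under [X in _ = ip X _]eq_fun do rewrite mulN1r addrC.
Qed.

Lemma ipDr f g h : torus_L2 f -> torus_L2 g -> torus_L2 h ->
  ip h (fun x => f x + g x) = ip h f + ip h g.
Proof.
move=> Lf Lg Lh.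
by rewrite (ip_conj (L2_D Lf Lg) Lh) ipDl// conjD -(ip_conj Lf Lh) -(ip_conj Lg Lh).
Qed.

Lemma ipZr a f h : torus_L2 f -> torus_L2 h ->
  ip h (fun x => a * f x) = conjc a * ip h f.
Proof.
by move=> Lf Lh; rewrite (ip_conj (L2_Z a Lf) Lh) ipZl// conjM -(ip_conj Lf Lh).
Qed.

Lemma ip_suml (F : nat -> X -> R[i]) m h : (forall i, torus_L2 (F i)) ->
  torus_L2 h -> ip (fun x => \sum_(i < m) F i x) h = \sum_(i < m) ip (F i) h.
Proof.
move=> LF Lh; elim: m => [|m IH].
  by under [X in ip X]eq_fun do rewrite big_ord0; rewrite ip0l big_ord0.
under [X in ip X]eq_fun do rewrite big_ord_recr.
by rewrite ipDl// ?IH ?big_ord_recr//; exact: L2_sum.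
Qed.

Lemma ip_sumr (F : nat -> X -> R[i]) m h : (forall i, torus_L2 (F i)) ->
  torus_L2 h -> ip h (fun x => \sum_(i < m) F i x) = \sum_(i < m) ip h (F i).
Proof.
move=> LF Lh; rewrite (ip_conj _ Lh); last exact: L2_sum.
rewrite ip_suml// conj_sum; apply: eq_bigr => i _.
by rewrite -(ip_conj (LF i) Lh).
Qed.

Lemma nsqD f g : torus_L2 f -> torus_L2 g ->
  nsq (fun x => f x + g x) = nsq f + 2 * complex.Re (ip f g) + nsq g.
Proof.
move=> Lf Lg; have Lfg := L2_D Lf Lg.
have := ip_nsq (fun x => f x + g x).
rewrite ipDl// !ipDr// !ip_nsq (ip_conj Lf Lg).
move/(congr1 (@complex.Re R)); rewrite !complexReD Re_conjc => /= <-; ring.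
Qed.

Lemma nsqZ a f : torus_L2 f ->
  nsq (fun x => a * f x) = Normc.normc a ^+ 2 * nsq f.
Proof.
move=> Lf; rewrite /nsq -RintegralZl//; last exact: L2_integrable.
by apply: eq_Rintegral => x _; rewrite Normc.normcM exprMn.
Qed.

(** Expanding the squared norm of af + g with a = -s conj<f,g> gives a real quadratic in s that is
    never negative; s = 1/|f|^2 yields the inequality. *)
Lemma cauchy_schwarz f g : torus_L2 f -> torus_L2 g ->
  Normc.normc (ip f g) <= L2norm f * L2norm g.
Proof.
move=> Lf Lg.
have key (s : R) : 0 <= s ^+ 2 * Normc.normc (ip f g) ^+ 2 * nsq f -
    2 * s * Normc.normc (ip f g) ^+ 2 + nsq g.
  pose a := (- s)%:C%C * conjc (ip f g).
  have := nsq_ge0 (fun x => a * f x + g x).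
  rewrite nsqD//; last exact: L2_Z.
  rewrite nsqZ// ipZl// /a Normc.normcM exprMn !sqr_normcE Re_conjc Im_conjc.
  rewrite -mulrA [conjc _ * _]mulrC mulc_conjE sqr_normcE complexReM /=.
  by move=> H; apply: le_trans H _; rewrite le_eqVlt; apply/orP; left; apply/eqP; ring.
rewrite -(@ler_pXn2r _ 2)//; last 2 first.
- by rewrite nnegrE normc_ge0.
- by rewrite nnegrE mulr_ge0 ?L2norm_ge0.
rewrite exprMn !L2norm_sqr.
have := nsq_ge0 f; rewrite le_eqVlt => /predU1P[f0|f0].
  (* If |f| = 0 the quadratic is affine in s with slope -2|<f,g>|^2; this choice of s makes it at
     most -2, which is absurd unless <f,g> = 0. *)
  rewrite -f0 mul0r leNgt; apply/negP => c0.
  have := key ((nsq g + 1) / Normc.normc (ip f g) ^+ 2).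
  rewrite -f0 mulr0 add0r -mulrA -mulrA mulVf ?gt_eqF//.
  by have := nsq_ge0 g; lra.
have := key (nsq f)^-1.
rewrite -subr_ge0 => H; rewrite -subr_ge0.
rewrite [X in 0 <= X](_ : _ = nsq f * ((nsq f)^-1 ^+ 2 * Normc.normc (ip f g) ^+ 2 * nsq f -
  2 * (nsq f)^-1 * Normc.normc (ip f g) ^+ 2 + nsq g - 0)).
  by rewrite mulr_ge0 ?nsq_ge0// subr0.
by field; rewrite gt_eqF.
Qed.

Lemma L2norm_triangle f g : torus_L2 f -> torus_L2 g ->
  L2norm (fun x => f x + g x) <= L2norm f + L2norm g.
Proof.
move=> Lf Lg; rewrite -(@ler_pXn2r _ 2)//; last 2 first.
- by rewrite nnegrE L2norm_ge0.
- by rewrite nnegrE addr_ge0 ?L2norm_ge0.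
rewrite L2norm_sqr nsqD// sqrrD !L2norm_sqr lerD2r lerD2l -[leRHS]mulr_natl.
by rewrite ler_pM2l// (le_trans (Re_le_normc _))// cauchy_schwarz.
Qed.

Lemma L2normZ a f : torus_L2 f -> L2norm (fun x => a * f x) = Normc.normc a * L2norm f.
Proof.
by move=> Lf; rewrite !L2normE nsqZ// sqrtrM ?sqr_ge0// sqrtr_sqr ger0_norm ?normc_ge0.
Qed.

Lemma L2norm_dist_triangle g f h : torus_L2 f -> torus_L2 g -> torus_L2 h ->
  L2norm (fun x => f x - h x) <=
  L2norm (fun x => f x - g x) + L2norm (fun x => g x - h x).
Proof.
move=> Lf Lg Lh.
rewrite [X in L2norm X](_ : _ = fun x => (f x - g x) + (g x - h x)).
  by apply: L2norm_triangle; exact: L2_B.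
by apply/funext => x; rewrite addrA subrK.
Qed.

Lemma L2norm0 : L2norm (fun _ : X => 0 : R[i]) = 0.
Proof.
rewrite L2normE /nsq; under eq_Rintegral do rewrite Normc.normc0 expr0n/=.
by rewrite Rintegral_cst// mul0r sqrtr0.
Qed.

(** Elements of L^2 are represented by functions; almost-everywhere identities enter the later
    estimates as a difference of norm 0. *)
Lemma L2eq_norm0 f g : torus_L2 f -> torus_L2 g -> L2eq f g ->
  L2norm (fun x => f x - g x) = 0.
Proof.
move=> Lf Lg fg; rewrite -[RHS]L2norm0 !L2normE /nsq /Rintegral; congr (Num.sqrt (fine _)).
apply: ae_eq_integral => //.
- by apply/measurable_EFinP; exact: (L2_measurable_nsq (L2_B Lf Lg)).
- by apply: filterS fg => x fgx _ /=; rewrite fgx subrr.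
Qed.

Lemma ip_congr f g h : torus_L2 f -> torus_L2 g -> torus_L2 h ->
  L2norm (fun x => f x - g x) = 0 -> ip f h = ip g h.
Proof.
move=> Lf Lg Lh fg0; apply/eqP; rewrite -subr_eq0 -ipBl//; apply/eqP.
apply: Normc.eq0_normc; apply/eqP; rewrite eq_le normc_ge0 andbT.
by rewrite (le_trans (cauchy_schwarz (L2_B Lf Lg) Lh))// fg0 mul0r.
Qed.

End L2.

(** * Traces along Hilbert bases *)

Section csum_nonneg.
Variables (R : realType) (I : choiceType).

(** Of the four sums in [csum] (positive and negative parts of real and imaginary parts) only one
    survives for nonnegative real terms. *)
Lemma csum_ge0 (f : I -> R[i]) (r : I -> R) (t : R) :
  (forall i, f i = (r i)%:C%C) -> (forall i, 0 <= r i) ->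
  (\esum_(i in [set: I]) (r i)%:E = t%:E)%E ->
  abs_summable f /\ csum f = t%:C%C.
Proof.
move=> fr r0 rt.
have -> : f = fun i => (r i)%:C%C by exact/funext.
split.
  rewrite /abs_summable /summable (_ : (\esum_(i in _) _)%E = t%:E) ?ltry//.
  rewrite -rt; apply: eq_esum => i _ /=.
  by rewrite expr0n addr0 sqrtr_sqr !ger0_norm.
rewrite /csum /=; congr Complex.
- rewrite [X in fine X - _](_ : _ = t%:E); last first.
    rewrite -rt; apply: eq_esum => i _.
    by rewrite funeposE/=; apply/max_idPl; rewrite lee_fin.
  rewrite [X in _ - fine X](_ : _ = 0%:E) ?subr0//.
  apply: esum1 => i _.
  by rewrite funenegE/=; apply/max_idPr; rewrite lee_fin lerNl oppr0.
- rewrite esum1 ?esum1 ?subr0// => i _.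
  + by rewrite funenegE /= oppr0 maxxx.
  + by rewrite funeposE /= maxxx.
Qed.

End csum_nonneg.

(** * Operators that are diagonal in a Hilbert basis *)

Section hilbert.
Variables (R : realType) (n : nat).
Local Notation X := (n.-tuple (measurableTypeR R)).
Local Notation ip := (@L2inner R n).
Implicit Types f g h : X -> R[i].

(** [F] acts on functions rather than on classes, hence linearity only almost everywhere. The
    interface covers both the identity, for Parseval, and each [S t]. *)
Record L2_operator (F : (X -> R[i]) -> X -> R[i]) : Prop := {
  L2op_L2 : forall f, torus_L2 f -> torus_L2 (F f) ;
  L2op_lin : forall (a : R[i]) f g, torus_L2 f -> torus_L2 g ->
    L2eq (F (fun x => a * f x + g x)) (fun x => a * F f x + F g x) ;
  L2op_bounded : exists C : R, forall f, torus_L2 f ->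
    L2norm (F f) <= C * L2norm f }.

Lemma L2_operator_id : L2_operator id.
Proof.
split => // [a f g _ _|]; first exact: aeW.
by exists 1 => f _; rewrite mul1r.
Qed.

Section operator.
Variable F : (X -> R[i]) -> X -> R[i].
Hypothesis opF : L2_operator F.

Lemma L2op_norm0 f : torus_L2 f -> L2norm f = 0 -> L2norm (F f) = 0.
Proof.
move=> Lf f0; have [C HC] := L2op_bounded opF.
by apply/eqP; rewrite eq_le L2norm_ge0 andbT (le_trans (HC _ Lf))// f0 mulr0.
Qed.

Lemma L2op_ip_lin a f g h : torus_L2 f -> torus_L2 g -> torus_L2 h ->
  ip (F (fun x => a * f x + g x)) h = a * ip (F f) h + ip (F g) h.
Proof.
move=> Lf Lg Lh; have [LFf LFg] := (L2op_L2 opF Lf, L2op_L2 opF Lg).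
have L1 := L2op_L2 opF (L2_lin a Lf Lg); have L2 := L2_lin a LFf LFg.
rewrite -ip_lin//; apply: ip_congr => //; apply: L2eq_norm0 => //.
exact: L2op_lin.
Qed.

Lemma L2op_ip_sum (c : nat -> R[i]) (b : nat -> X -> R[i]) m h :
  (forall i, torus_L2 (b i)) -> torus_L2 h ->
  ip (F (fun x => \sum_(i < m) c i * b i x)) h =
  \sum_(i < m) c i * ip (F (b i)) h.
Proof.
move=> Lb Lh; elim: m => [|m IH].
  under [X in F X]eq_fun do rewrite big_ord0; rewrite big_ord0.
  rewrite -[RHS](ip0l h); apply: ip_congr => //.
  - by apply: L2op_L2 => //; exact: L2_0.
  - exact: L2_0.
  - under eq_fun do rewrite subr0.
    by apply: L2op_norm0 (L2norm0 R n); exact: L2_0.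
under [X in F X]eq_fun do rewrite big_ord_recr/= addrC.
rewrite L2op_ip_lin//; last by apply: (L2_sum (F := fun i x => c i * b i x)) => i; exact: L2_Z.
by rewrite IH big_ord_recr addrC.
Qed.

End operator.

Section basis.
Variable b : nat -> X -> R[i].
Hypothesis hb : hilbert_basis b.

Let Lb i : torus_L2 (b i). Proof. by case: hb. Qed.

Let ortho i j : ip (b i) (b j) = (i == j)%:R. Proof. by case: hb. Qed.

Definition fourier_sum f m : X -> R[i] :=
  fun x => \sum_(i < m) ip f (b i) * b i x.

Lemma L2_comb (c : nat -> R[i]) m : torus_L2 (fun x => \sum_(i < m) c i * b i x).
Proof. by apply: (L2_sum (F := fun i x => c i * b i x)) => i; exact: L2_Z. Qed.

Lemma ip_comb (c : nat -> R[i]) m j :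
  ip (fun x => \sum_(i < m) c i * b i x) (b j) = if (j < m)%N then c j else 0.
Proof.
rewrite (ip_suml (F := fun i x => c i * b i x))//; last by move=> i; exact: L2_Z.
under eq_bigr do rewrite ipZl// ortho.
case: ifPn => jm.
  rewrite (bigD1 (Ordinal jm))//= eqxx mulr1 big1 ?addr0// => i ij.
  by rewrite (_ : _ == _ = false) ?mulr0//; apply: contraNF ij => /eqP ij;
    apply/eqP/val_inj.
rewrite big1// => i _; rewrite (_ : _ == _ = false) ?mulr0//.
by apply: contraNF jm => /eqP <-.
Qed.

(** Pythagoras: the residual of the Fourier sum is orthogonal to the span of the first m vectors,
    which contains the correction [d] to any other combination. *)
Lemma fourier_sum_best f (c : nat -> R[i]) m : torus_L2 f ->
  L2norm (fun x => f x - fourier_sum f m x) <=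
  L2norm (fun x => f x - \sum_(i < m) c i * b i x).
Proof.
move=> Lf; have Lp : torus_L2 (fourier_sum f m) by exact: (L2_comb (fun i => ip f (b i))).
pose d := fun x => \sum_(i < m) (ip f (b i) - c i) * b i x.
have Ld : torus_L2 d by exact: (L2_comb (fun i => ip f (b i) - c i)).
rewrite [X in _ <= L2norm X](_ : _ = fun x => (f x - fourier_sum f m x) + d x).
  rewrite !L2normE (nsqD (L2_B Lf Lp) Ld).
  apply: ler_wsqrtr; rewrite (_ : ip _ d = 0).
    by rewrite mulr0 addr0 lerDl nsq_ge0.
  rewrite (ip_sumr (F := fun i x => (ip f (b i) - c i) * b i x))//.
  - rewrite big1// => i _; rewrite ipZr//; last exact: L2_B.
    by rewrite ipBl// /fourier_sum (ip_comb (fun i => ip f (b i))) ltn_ord subrr mulr0.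
  - by move=> i; exact: L2_Z.
  - exact: L2_B.
apply/funext => x; rewrite -addrA; congr (_ + _).
rewrite /fourier_sum /d -sumrN -sumrN -big_split/=; apply: eq_bigr => i _.
by rewrite mulrBl addrA addNr add0r.
Qed.

Lemma fourier_sum_cvg f : torus_L2 f ->
  L2norm (fun x => f x - fourier_sum f m x) @[m --> \oo] --> (0 : R).
Proof.
move=> Lf; apply/cvgrPdist_lt => e e0.
have [_ _ /(_ f Lf e e0)[M [c Mc]]] := hb.
exists M => // m /= Mm; rewrite sub0r normrN ger0_norm ?L2norm_ge0//.
apply: le_lt_trans Mc.
(* Padding with zeros turns the approximation of length M into one of every length m >= M, so best
   approximation controls the whole tail. *)
pose c' i := if (i < M)%N then c i else 0.
rewrite (le_trans (fourier_sum_best c' m Lf))// le_eqVlt; apply/orP; left; apply/eqP.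
congr L2norm; apply/funext => x; congr (_ - _).
rewrite (big_ord_widen _ (fun i => c i * b i x) Mm) [RHS]big_mkcond/=.
by apply: eq_bigr => i _; rewrite /c'; case: ifP => // _; rewrite mul0r.
Qed.

Variables (F : (X -> R[i]) -> X -> R[i]) (lam : nat -> R).
Hypothesis opF : L2_operator F.
Hypothesis lam0 : forall i, 0 <= lam i.
Hypothesis eigF : forall i, L2norm (fun x => F (b i) x - (lam i)%:C%C * b i x) = 0.

Lemma form_partial f m : torus_L2 f -> ip (F (fourier_sum f m)) f =
  (\sum_(i < m) lam i * Normc.normc (ip f (b i)) ^+ 2)%:C%C.
Proof.
move=> Lf; rewrite (L2op_ip_sum opF (fun i => ip f (b i)))// rmorph_sum.
apply: eq_bigr => i _.
rewrite [ip (F _) _](ip_congr (g := fun x => (lam i)%:C%C * b i x))//.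
- by rewrite ipZl// (ip_conj Lf (Lb i)) mulrCA mulc_conjE -rmorphM.
- exact: L2op_L2.
- exact: L2_Z.
Qed.

(** The difference is <F(f - p_m), f> with p_m the Fourier sum; boundedness of [F] and
    Cauchy-Schwarz bound it by C |f - p_m| |f|. *)
Lemma form_cvg f : torus_L2 f ->
  Normc.normc (ip (F f) f -
    (\sum_(i < m) lam i * Normc.normc (ip f (b i)) ^+ 2)%:C%C) @[m --> \oo]
    --> (0 : R).
Proof.
move=> Lf; have [C HC] := L2op_bounded opF.
have Lp m : torus_L2 (fourier_sum f m) by exact: (L2_comb (fun i => ip f (b i))).
apply: (@squeeze_cvgr _ _ _ _ (fun=> 0) (fun m =>
  C * L2norm (fun x => f x - fourier_sum f m x) * L2norm f)).
- apply: nearW => m; rewrite normc_ge0 -form_partial//.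
  rewrite [X in Normc.normc X](_ : _ = ip (F (fun x => f x - fourier_sum f m x)) f).
    rewrite (le_trans (cauchy_schwarz _ Lf))//.
      by apply: L2op_L2 => //; exact: L2_B.
    by rewrite ler_wpM2r ?L2norm_ge0// HC//; exact: L2_B.
  under [in RHS]eq_fun do rewrite addrC -mulN1r.
  by rewrite L2op_ip_lin// mulN1r addrC.
- exact: cvg_cst.
- rewrite (_ : 0 = C * 0 * L2norm f); last by rewrite mulr0 mul0r.
  by apply: cvgMl; apply: cvgMr; exact: fourier_sum_cvg.
Qed.

Lemma form_series f : torus_L2 f -> exists r : R,
  [/\ 0 <= r, ip (F f) f = r%:C%C &
    (\sum_(i <oo) (lam i * Normc.normc (ip f (b i)) ^+ 2)%:E = r%:E)%E].
Proof.
move=> Lf; have := form_cvg Lf.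
set s := fun m => \sum_(i < m) lam i * Normc.normc (ip f (b i)) ^+ 2.
move=> cv.
(* The partial sums are real, so their distance to <F f, f> is at least the modulus of its imaginary
   part. *)
have Im0 : complex.Im (ip (F f) f) = 0.
  apply/eqP; rewrite -normr_eq0 -sqrf_eq0; apply/negPn/negP => I0.
  have {}I0 : 0 < `|complex.Im (ip (F f) f)| by rewrite lt_neqAle normr_ge0 andbT eq_sym -sqrf_eq0.
  move/cvgrPdist_lt : cv => /(_ _ I0) [M _ /(_ M (leqnn M))] /=.
  rewrite sub0r normrN ger0_norm ?normc_ge0// ltNge => /negP; apply.
  case: (ip (F f) f) => u v /=; rewrite subr0 -sqrtr_sqr; apply: ler_wsqrtr.
  by rewrite lerDr sqr_ge0.
have Re_cvg : s m @[m --> \oo] --> complex.Re (ip (F f) f).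
  apply/cvgrPdist_lt => e e0; move/cvgrPdist_lt : cv => /(_ _ e0).
  apply: filterS => m; rewrite sub0r normrN ger0_norm ?normc_ge0//.
  apply: le_lt_trans; rewrite -/(s m); move: Im0; case: (ip (F f) f) => u v /= ->.
  by rewrite subr0 expr0n addr0 sqrtr_sqr.
exists (complex.Re (ip (F f) f)); split.
- apply: (cvgr_to_ge Re_cvg); apply: nearW => m.
  by apply: sumr_ge0 => i _; rewrite mulr_ge0 ?sqr_ge0.
- by move: Im0; case: (ip (F f) f) => u v /= ->.
- apply/cvg_lim => //; apply: cvg_EFin.
    by apply: nearW => m; rewrite sumEFin.
  apply: cvg_trans Re_cvg; apply: near_eq_cvg; apply: nearW => m.
  by rewrite /= sumEFin/= /s big_mkord.
Qed.

End basis.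

(** The case of the identity operator, with all eigenvalues 1. *)
Lemma parseval (b : nat -> X -> R[i]) f : hilbert_basis b -> torus_L2 f ->
  (\sum_(i <oo) (Normc.normc (ip f (b i)) ^+ 2)%:E = (nsq f)%:E)%E.
Proof.
move=> hb Lf.
have [//|i|r [_]] := form_series hb L2_operator_id (lam := fun=> 1) _ _ Lf.
- by under eq_fun do rewrite mul1r subrr; rewrite L2norm0.
- rewrite ip_nsq => -[->] <-; by apply: eq_eseriesr => i _; rewrite mul1r.
Qed.

Lemma trace_diagonal (e : nat -> X -> R[i]) F (lam : nat -> R) (t : R) :
  hilbert_basis e -> L2_operator F -> (forall k, 0 <= lam k) ->
  (forall k, L2norm (fun x => F (e k) x - (lam k)%:C%C * e k x) = 0) ->
  (\sum_(k <oo) (lam k)%:E = t%:E)%E -> has_L2_trace F t%:C%C.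
Proof.
move=> he opF lam0 eigF lamt b hb.
have Lb i : torus_L2 (b i) by case: hb.
have Le i : torus_L2 (e i) by case: he.
have /choice[r Hr] i := form_series he opF lam0 eigF (Lb i).
apply: (csum_ge0 (r := r)) => [i|i|]; try by case: (Hr i).
rewrite -nneseries_esumT; last by move=> i; rewrite lee_fin; case: (Hr i).
rewrite (_ : (\sum_(i <oo) _)%E = (\sum_(i <oo) \sum_(k <oo)
    (lam k * Normc.normc (ip (b i) (e k)) ^+ 2)%:E)%E); last first.
  by apply: eq_eseriesr => i _; case: (Hr i).
(* Tonelli: all terms are nonnegative. *)
rewrite nneseries_interchange; last first.
  by move=> i j; rewrite lee_fin mulr_ge0 ?sqr_ge0.
rewrite -lamt; apply: eq_eseriesr => k _.
under eq_eseriesr do rewrite EFinM (ip_conj (Le _) (Lb _)).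
rewrite nneseriesZl; last by move=> i _; rewrite lee_fin sqr_ge0.
rewrite [X in (_ * X)%E](_ : _ = 1%E) ?mule1//.
(* Parseval for the unit vector [e k] in the basis [b]; conjugating the coefficients does not change
   their moduli. *)
transitivity (nsq (e k))%:E.
  rewrite -(parseval hb (Le k)); apply: eq_eseriesr => i _.
  by rewrite !sqr_normcE Re_conjc Im_conjc sqrrN.
by have := ip_nsq (e k); case: he => _ -> _; rewrite eqxx => -[<-].
Qed.

Lemma L2_trace_diagonal (e : nat -> X -> R[i]) F (lam : nat -> R) (t : R) :
  hilbert_basis e -> L2_operator F -> (forall k, 0 <= lam k) ->
  (forall k, L2norm (fun x => F (e k) x - (lam k)%:C%C * e k x) = 0) ->
  (\sum_(k <oo) (lam k)%:E = t%:E)%E ->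
  L2_trace_class F /\ L2_trace F = t%:C%C.
Proof.
move=> he opF lam0 eigF lamt.
have tr := trace_diagonal he opF lam0 eigF lamt.
split; first by exists t%:C%C.
(* The value picked by [xget] is pinned down by evaluating both candidates along the basis [e]. *)
rewrite /L2_trace; case: xgetP => [x _ trx|/(_ t%:C%C)/(_ tr)//].
by have [_ <-] := trx e he; have [_ <-] := tr e he.
Qed.

End hilbert.

(** * Characters of the torus *)

Lemma bounded_integrable d (T : measurableType d) (R : realType)
    (m : {measure set T -> \bar R}) (f : T -> R) (M : R) :
  (m setT < +oo)%E -> measurable_fun setT f -> (forall x, `|f x| <= M) ->
  m.-integrable setT (EFin \o f).
Proof.
move=> moo mf fM; apply: measurable_bounded_integrable => //.
exists M; split; first exact: num_real.
by move=> y My x _ /=; exact: le_trans (fM x) (ltW My).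
Qed.

Lemma finite_bounded_integrable d (T : measurableType d) (R : realType)
    (m : {finite_measure set T -> \bar R}) (f : T -> R) (M : R) :
  measurable_fun setT f -> (forall x, `|f x| <= M) ->
  m.-integrable setT (EFin \o f).
Proof.
by move=> mf fM; apply: bounded_integrable fM => //; rewrite -ge0_fin_numE// fin_num_measure.
Qed.

(** * Integrals of cosines over the circle *)

Section circle.
Variable R : realType.
Local Notation leb := (@lebesgue_measure R).

Lemma cos_periodz (m : int) (c : R) : cos (m%:~R * (2 * pi) + c) = cos c.
Proof.
have H k (a : R) : cos (k%:R * (2 * pi) + a) = cos a.
  rewrite addrC -[2 * pi]/(2%:R * pi) [2%:R * pi]mulr_natl [k%:R * _]mulr_natl.
  by rewrite (periodicn (@cosD2pi R)).
case: m => k; first by rewrite -pmulrn.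
by rewrite NegzE mulrNz -pmulrn -[LHS](H k.+1) mulNr addrA subrr add0r.
Qed.

(** The complement of the interval is null for the restricted measure, and on subsets of the
    interval both measures agree. The bound M gives integrability. *)
Lemma Rintegral_circle (f : measurableTypeR R -> R) (M : R) :
  measurable_fun setT f -> (forall x, `|f x| <= M) ->
  (\int[circle_measure R]_x f x = \int[leb]_(x in `[0%R, (2 * pi)%R[) f x)%R.
Proof.
move=> mf fM; rewrite /Rintegral; congr fine.
have mD : measurable (`[0%R, (2 * pi)%R[%classic : set (measurableTypeR R)).
  exact: measurable_itv.
have mDC := measurableC mD.
have fi := finite_bounded_integrable (circle_measure R) mf fM.
have D0 : circle_measure R (~` `[0%R, (2 * pi)%R[%classic) = 0%E.
  by rewrite /circle_measure /= /mfrestr /mrestr setICl measure0.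
etransitivity; first exact: (negligible_integral mDC measurableT fi D0).
rewrite setTD setCK; apply: eq_measure_integral => A mA AD.
by rewrite /circle_measure /= /mfrestr /mrestr setIidl.
Qed.

Lemma measurable_cos_lin (a c : R) :
  measurable_fun setT (fun x : measurableTypeR R => cos (a * x + c)).
Proof.
apply: (@measurableT_comp _ _ _ _ _ _ (@cos R)).
  apply: continuous_measurable_fun; exact: continuous_cos.
by apply: measurable_funD => //; apply: measurable_funM.
Qed.

Lemma is_derive_lin (a c x : R) : is_derive x 1 (fun y => a * y + c) a.
Proof.
rewrite [X in is_derive _ _ X](_ : _ = (a \*: (@id R)) + cst c); last exact/funext.
by apply: is_derive_eq; rewrite addr0 -[RHS]mulr1.
Qed.

Lemma is_derive_sin_lin (a c x : R) :
  is_derive x 1 (fun y => sin (a * y + c)) (cos (a * x + c) * a).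
Proof.
exact: (is_derive1_comp (is_derive_sin _) (is_derive_lin _ _ _)).
Qed.

Lemma circle_cos (m : int) (c : R) :
  (\int[circle_measure R]_x cos (m%:~R * x + c) =
   if m == 0 then 2 * pi * cos c else 0)%R.
Proof.
rewrite (@Rintegral_circle _ 1); last 2 first.
- exact: measurable_cos_lin.
- by move=> x; exact: cos_max.
have pi0 : 0 < 2 * pi :> R by rewrite mulr_gt0// pi_gt0.
case: eqVneq => [->|m0].
  under eq_Rintegral do rewrite mul0r add0r.
  rewrite Rintegral_cst//.
  rewrite mulrC; congr (_ * _).
  have : leb [set` `[0%R, (2 * pi)%R[] = (2 * pi)%:E.
    by rewrite lebesgue_measure_itv/= lte_fin pi0 -EFinB subr0.
  by move/(congr1 fine).
have m0' : m%:~R != 0 :> R by rewrite intr_eq0.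
have cont (d : R) : continuous (fun y : R => d * cos (m%:~R * y + c)).
  move=> x; apply: cvgMr; apply: continuous_comp; last exact: continuous_cos.
  by apply: cvgD; [apply: cvgMr|exact: cvg_cst].
have contS : continuous (fun y : R => sin (m%:~R * y + c)).
  move=> x; apply: continuous_comp; last exact: continuous_sin.
  by apply: cvgD; [apply: cvgMr|exact: cvg_cst].
have int (d : R) b : leb.-integrable [set` Interval (BLeft 0) (BSide b (2 * pi))]
    (EFin \o (fun x => d * cos (m%:~R * x + c))).
  have H := continuous_compact_integrable (@segment_compact _ 0 (2 * pi))
    (continuous_subspaceT (cont d)).
  by apply: integrableS H => //; apply: subset_itvl; rewrite bnd_simp; case: b.
(* Inserting the factor m makes the integrand the exact derivative of sin(mx + c), which takes the
   same value at 0 and 2 pi. *)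
have -> : \int[leb]_(x in `[0, 2 * pi[) cos (m%:~R * x + c) =
    m%:~R^-1 * \int[leb]_(x in `[0, 2 * pi[) (m%:~R * cos (m%:~R * x + c)).
  rewrite RintegralZl//; last first.
    by have := int 1 true; under [X in EFin \o X]eq_fun do rewrite mul1r.
  by rewrite mulrA mulVf// mul1r.
rewrite Rintegral_itv_bndo_bndc; last exact: int.
rewrite /Rintegral (@continuous_FTC2 _ _ (fun y => sin (m%:~R * y + c)))//.
- rewrite mulr0 add0r /=.
  have -> : sin (m%:~R * (2 * pi) + c) = sin c.
    by rewrite -!cosBpihalf -addrA cos_periodz.
  by rewrite subrr mulr0.
- exact: continuous_subspaceT.
- split => [x _||].
  + by have [] := is_derive_sin_lin m%:~R c x.
  + exact/cvg_at_right_filter/contS.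
  + exact/cvg_at_left_filter/contS.
- move=> x _; rewrite derive1E; have [_ ->] := is_derive_sin_lin m%:~R c x.
  by rewrite mulrC.
Qed.

End circle.

(** * Integrals of cosines over the torus and orthonormality of the characters *)

Section torus_integral.
Variable R : realType.
Local Notation X n := (n.-tuple (measurableTypeR R)).

Definition phase n (m : 'rV[int]_n) (x : X n) : R :=
  \sum_(i < n) (m 0 i)%:~R * tnth x i.

Lemma measurable_phase n (m : 'rV[int]_n) : measurable_fun setT (phase m).
Proof.
apply: measurable_sum => i.
by apply: measurable_funM => //; exact: measurable_tnth.
Qed.

Lemma measurable_cos_phase n (m : 'rV[int]_n) c :
  measurable_fun setT (fun x : X n => cos (phase m x + c)).
Proof.
apply: (@measurableT_comp _ _ _ _ _ _ (@cos R)).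
  by apply: continuous_measurable_fun; exact: continuous_cos.
by apply: measurable_funD => //; exact: measurable_phase.
Qed.

Lemma phase_prepend n (m : 'rV[int]_n.+1) (p : measurableTypeR R * X n) :
  phase m (prependT p) =
  (m 0 ord0)%:~R * p.1 + phase (\row_i m 0 (lift ord0 i)) p.2.
Proof.
rewrite /phase big_ord_recl/=; congr (_ * _ + _).
by apply: eq_bigr => i _; rewrite mxE tnthS.
Qed.

(* The arbitrary phase c covers sines as well, and absorbs the first coordinate
   in the induction. *)
Lemma torus_cos n (m : 'rV[int]_n) (c : R) :
  (\int[torus_measure R n]_x cos (phase m x + c) =
   if m == 0 then (2 * pi) ^+ n * cos c else 0)%R.
Proof.
elim: n m c => [|n IH] m c.
  rewrite (_ : m == 0); last by apply/eqP/rowP; case.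
  rewrite expr0 mul1r /Rintegral /= integral_dirac//; last first.
    by apply/measurable_EFinP; exact: measurable_cos_phase.
  by rewrite diracT mul1e /= /phase big_ord0 add0r.
pose m' : 'rV[int]_n := \row_i m 0 (lift ord0 i).
pose F (p : measurableTypeR R * X n) : \bar R :=
  (cos (phase m (prependT p) + c))%:E.
have mF : measurable_fun setT (fun p : measurableTypeR R * X n => cos (phase m (prependT p) + c)).
  apply: (measurableT_comp (measurable_cos_phase m c)).
  exact: measurable_prependT.
have iF : (circle_measure R \x torus_measure R n)%E.-integrable setT F.
  apply: (@bounded_integrable _ _ _ _ _ 1) => [|//|p]; last exact: cos_max.
  have h : ((circle_measure R \x torus_measure R n) setT < +oo)%E.
    rewrite -setXTT product_measure1E//.
    by rewrite lte_mul_pinfty// ?fin_num_measure// ltey_eq fin_num_measure.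
  exact: h.
(* The measure in dimension n + 1 is the pushforward of a product under [prependT], so Fubini splits
   off the first coordinate. *)
have step : \int[torus_measure R n.+1]_x cos (phase m x + c) =
    fine (\int[circle_measure R]_a \int[torus_measure R n]_y F (a, y))%E.
  rewrite /Rintegral; congr fine.
  rewrite (integral12_prod_meas1 iF).
  have mG : measurable_fun setT (fun x : X n.+1 => (cos (phase m x + c))%:E).
    by apply/measurable_EFinP; exact: measurable_cos_phase.
  exact: (integral_pushforward (@measurable_prependT R n) mG iF measurableT).
have inner a : (\int[torus_measure R n]_y F (a, y) =
    (if m' == 0%R then (2 * pi) ^+ n * cos ((m 0 ord0)%:~R * a + c) else 0)%:E)%E.
  rewrite -IH /Rintegral fineK; last first.
    apply: integrable_fin_num => //.
    exact: (finite_bounded_integrable _ (measurable_cos_phase m' _)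
      (fun x => cos_max _)).
  by apply: eq_integral => y _; rewrite /F phase_prepend/= -/m' -addrA addrCA.
rewrite step; under eq_integral do rewrite inner.
have -> : (m == 0) = (m 0 ord0 == 0) && (m' == 0).
  apply/eqP/andP => [m0|[/eqP m00 /eqP m'0]].
    by split; [rewrite m0 mxE|apply/eqP/rowP => i; rewrite !mxE m0 mxE].
  apply/rowP => i; rewrite mxE; have [->//|i0] := eqVneq i ord0.
  have [j ->] : exists j, i = lift ord0 j.
    by have := unliftP ord0 i; case=> [j ->|/eqP]; [exists j|rewrite (negPf i0)].
  by have := congr1 (fun z : 'rV_n => z 0 j) m'0; rewrite !mxE.
case: (m' == 0); last by rewrite andbF integral0.
rewrite andbT -[LHS]/(\int[circle_measure R]_x ((2 * pi) ^+ n * cos ((m 0 ord0)%:~R * x + c)))%R.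
rewrite RintegralZl//; last first.
  by apply: (finite_bounded_integrable _ (measurable_cos_lin _ _)) => x; exact: cos_max.
by rewrite circle_cos; case: ifP => _; rewrite ?mulr0// exprSr mulrA.
Qed.

Section characters.
Variable n : nat.
Implicit Types m : 'rV[int]_n.

(** The function exp(i m.x), left unnormalised so that products of such functions are again of this
    form. *)
Definition cisx m (x : X n) : R[i] := Complex (cos (phase m x)) (sin (phase m x)).

Definition torus_mass : R := (2 * pi) ^+ n.

(** The L^2-normalised character as a periodic function on all of R^n, which is where [laplacian]
    acts. *)
Definition uchar m (y : 'rV[R]_n) : R[i] :=
  let t := \sum_(i < n) (m 0 i)%:~R * y 0 i in
  (Num.sqrt torus_mass)^-1%:C%C * Complex (cos t) (sin t).

Definition torus_char m : X n -> R[i] := on_torus (uchar m).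

Lemma torus_mass_gt0 : 0 < torus_mass.
Proof. by rewrite exprn_gt0// mulr_gt0// pi_gt0. Qed.

Lemma torus_charE m x : torus_char m x = (Num.sqrt torus_mass)^-1%:C%C * cisx m x.
Proof.
rewrite /torus_char /on_torus /uchar /cisx /phase.
by under eq_bigr do rewrite mxE.
Qed.

Lemma phaseD m m' x : phase (m + m') x = phase m x + phase m' x.
Proof.
rewrite /phase -big_split/=; apply: eq_bigr => i _.
by rewrite mxE intrD mulrDl.
Qed.

Lemma phaseN m x : phase (- m) x = - phase m x.
Proof.
by rewrite /phase -sumrN; apply: eq_bigr => i _; rewrite mxE mulrNz mulNr.
Qed.

Lemma phase0 (x : X n) : phase 0 x = 0.
Proof. by rewrite /phase big1// => i _; rewrite mxE mul0r. Qed.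

Lemma cisxM m m' x : cisx m x * cisx m' x = cisx (m + m') x.
Proof. by rewrite /cisx phaseD cosD sinD; simpc; congr Complex; rewrite addrC. Qed.

Lemma cisx_conj m x : conjc (cisx m x) = cisx (- m) x.
Proof. by rewrite /cisx phaseN cosN sinN. Qed.

Lemma cisx0 (x : X n) : cisx 0 x = 1.
Proof. by rewrite /cisx phase0 cos0 sin0. Qed.

Lemma measurable_sin_phase m : measurable_fun setT (fun x : X n => sin (phase m x)).
Proof.
by under eq_fun do rewrite -cosBpihalf; exact: measurable_cos_phase.
Qed.

Lemma measurable_cos_phase0 m : measurable_fun setT (fun x : X n => cos (phase m x)).
Proof.
by under eq_fun do rewrite -[phase _ _]addr0; exact: measurable_cos_phase.
Qed.

Lemma normc_cisx m x : Normc.normc (cisx m x) ^+ 2 = 1.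
Proof. by rewrite sqr_normcE/= cos2Dsin2. Qed.

Lemma L2_cisx m : torus_L2 (cisx m).
Proof.
apply: (@L2_dom _ _ _ (fun=> 1)).
- exact: measurable_cos_phase0.
- exact: measurable_sin_phase.
- by apply: finite_measure_integrable_cst.
- by move=> x; rewrite normc_cisx.
Qed.

Lemma torus_char_fun m :
  torus_char m = fun x => (Num.sqrt torus_mass)^-1%:C%C * cisx m x.
Proof. by apply/funext => x; rewrite torus_charE. Qed.

Lemma L2_torus_char m : torus_L2 (torus_char m).
Proof. by rewrite torus_char_fun; apply: L2_Z; exact: L2_cisx. Qed.

(** A character times the conjugate of another is the character of the difference; [torus_cos]
    evaluates the real part with phase 0 and the imaginary part with phase -pi/2. *)
Lemma ip_cisx m m' : L2inner (cisx m) (cisx m') = if m == m' then torus_mass%:C%C else 0.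
Proof.
rewrite /L2inner.
have H x : cisx m x * conjc (cisx m' x) = cisx (m - m') x.
  by rewrite cisx_conj cisxM.
have -> : \int[torus_measure R n]_x complex.Re (cisx m x * conjc (cisx m' x)) =
    \int[torus_measure R n]_x cos (phase (m - m') x + 0).
  by apply: eq_Rintegral => x _; rewrite H addr0.
have -> : \int[torus_measure R n]_x complex.Im (cisx m x * conjc (cisx m' x)) =
    \int[torus_measure R n]_x cos (phase (m - m') x + - (pi / 2)).
  by apply: eq_Rintegral => x _; rewrite H cosBpihalf.
rewrite !torus_cos subr_eq0; case: ifP => // _.
by rewrite cos0 mulr1 cosN cos_pihalf mulr0.
Qed.

Lemma ip_torus_char m m' : L2inner (torus_char m) (torus_char m') = (m == m')%:R.
Proof.
have L := L2_cisx; rewrite !torus_char_fun ipZl//; last exact: L2_Z.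
rewrite ipZr// ip_cisx; case: eqVneq => _; last by rewrite !mulr0.
have s0 := torus_mass_gt0; rewrite conjc_real -!rmorphM/=.
rewrite mulrA -invfM -expr2 sqr_sqrtr ?ltW// mulVf// gt_eqF//.
Qed.

End characters.

End torus_integral.

(** * Density of trigonometric polynomials *)

Section sharp_cutoff.
Variable R : realType.
Implicit Types s q y : R.

Lemma bernoulli_le y m : 0 <= y <= 1 -> 1 - m%:R * y <= (1 - y) ^+ m.
Proof.
move=> /andP[y0 y1]; elim: m => [|m IH]; first by rewrite mul0r subr0.
rewrite exprSr (le_trans _ (ler_wpM2r _ IH)) ?subr_ge0//.
rewrite -natr1; have : 0 <= m%:R * y * y by rewrite !mulr_ge0.
by nra.
Qed.

(** The left side decreases in m, because (1 - y)(1 + (m + 1)y) <= 1 + my. *)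
Lemma bernoulli_ge y m : 0 <= y <= 1 -> (1 - y) ^+ m * (1 + m%:R * y) <= 1.
Proof.
move=> /andP[y0 y1].
have -> : 1 = (1 - y * y) ^+ 0 :> R by rewrite expr0.
elim: m => [|m IH]; first by rewrite !expr0 mul0r addr0 mulr1.
apply: le_trans IH; rewrite exprSr -mulrA ler_wpM2l ?exprn_ge0 ?subr_ge0//.
rewrite -natr1; have : 0 <= m%:R * y * y by rewrite !mulr_ge0.
by nra.
Qed.

(** With r the square root of q, k r^k stays below 1/(1 - r) by [bernoulli_ge] at y = 1 - r, and a
    factor r^k is left over. *)
Lemma natmul_expr_cvg0 q : 0 <= q < 1 -> k%:R * q ^+ k @[k --> \oo] --> (0 : R).
Proof.
move=> /andP[q0 q1].
pose r := Num.sqrt q.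
have r0 : 0 <= r by exact: sqrtr_ge0.
have r1 : r < 1 by rewrite -sqrtr1 ltr_sqrt.
have bnd k : k%:R * r ^+ k <= (1 - r)^-1.
  rewrite -[leRHS]mul1r ler_pdivlMr ?subr_gt0// -mulrA.
  have y01 : 0 <= 1 - r <= 1 by apply/andP; split; lra.
  have := bernoulli_ge k y01; rewrite opprB addrCA subrr addr0 mulrDr mulr1.
  have : 0 <= r ^+ k by rewrite exprn_ge0.
  by nra.
apply: (@squeeze_cvgr _ _ _ _ (fun=> 0) (fun k => (1 - r)^-1 * r ^+ k)).
- apply: nearW => k; rewrite mulr_ge0 ?exprn_ge0//=.
  rewrite -(sqr_sqrtr q0) -/r -exprM mulnC exprM expr2 mulrA.
  by rewrite ler_wpM2r ?exprn_ge0.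
- exact: cvg_cst.
- rewrite -[X in _ --> X](mulr0 (1 - r)^-1); apply: cvgMr.
  by apply: cvg_expr; rewrite ger0_norm.
Qed.

(* The extra factor k in the exponent k 2^k makes the limit at s = 1/2 equal to 0
   instead of exp(-1). *)
Definition cutoff (k : nat) s : R := (1 - s ^+ k) ^+ (k * 2 ^ k).

Lemma cutoff_itv k s : 0 <= s <= 1 -> 0 <= cutoff k s <= 1.
Proof.
move=> /andP[s0 s1]; have sk0 : 0 <= s ^+ k by rewrite exprn_ge0.
have sk1 : s ^+ k <= 1 by rewrite exprn_ile1.
rewrite /cutoff exprn_ge0 ?subr_ge0//= exprn_ile1 ?subr_ge0//.
by rewrite lerBlDr lerDl.
Qed.

(** For y = s^k and exponent m = k 2^k one has my = k(2s)^k. Below 1/2 this tends to 0 and the lower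
    Bernoulli bound forces the limit 1; from 1/2 on it is at least k and the upper bound gives 1/(k
    + 1). *)
Lemma cutoff_cvg s : 0 <= s <= 1 ->
  cutoff k s @[k --> \oo] --> ((s < 2^-1)%R%:R : R).
Proof.
move=> s01; have /andP[s0 s1] := s01.
have sk k : 0 <= s ^+ k <= 1 by rewrite exprn_ge0// exprn_ile1.
have mE k : (k * 2 ^ k)%:R * s ^+ k = k%:R * (2 * s) ^+ k.
  by rewrite natrM natrX exprMn mulrA.
case: ltP => s2.
- apply: (@squeeze_cvgr _ _ _ _ (fun k => 1 - k%:R * (2 * s) ^+ k) (fun=> 1)).
  + apply: nearW => k; have /andP[_ ->] := cutoff_itv k s01.
    by rewrite andbT -mE bernoulli_le.
  + rewrite -[X in _ --> X]subr0; apply: cvgB; first exact: cvg_cst.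
    by apply: natmul_expr_cvg0; rewrite mulr_ge0//=; lra.
  + exact: cvg_cst.
- apply: (@squeeze_cvgr _ _ _ _ (fun=> 0) (@harmonic R)).
  + apply: nearW => k; have /andP[-> _] := cutoff_itv k s01.
    rewrite /= -[leRHS]mul1r ler_pdivlMr ?ltr0n//.
    apply: le_trans (bernoulli_ge (k * 2 ^ k) (sk k)).
    rewrite ler_wpM2l ?mE//; first by have /andP[] := cutoff_itv k s01.
    rewrite -natr1 addrC lerD2l ler_peMr ?exprn_ege1//; lra.
  + exact: cvg_cst.
  + exact: cvg_harmonic.
Qed.

End sharp_cutoff.

(** * The fundamental domain carries the whole measure *)

Section torus_box.
Variable R : realType.
Local Notation X n := (n.-tuple (measurableTypeR R)).

Definition torus_box n : set (X n) := [set x | forall i, 0 <= tnth x i < 2 * pi].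

Arguments torus_box n : clear implicits.

Lemma measurable_torus_box n : measurable (torus_box n).
Proof.
have -> : torus_box n =
    \bigcap_(i in [set: 'I_n]) (@tnth n (measurableTypeR R) ^~ i @^-1` `[0, 2 * pi[%classic).
  by apply/seteqP; split => x /= xb i; have := xb i; rewrite /= in_itv/=; exact.
apply: fin_bigcap_measurable => [|i _]; first exact: finite_finset.
have mD : measurable (`[0, 2 * pi[%classic : set (measurableTypeR R)).
  exact: measurable_itv.
by have := @measurable_tnth _ (measurableTypeR R) n i measurableT _ mD; rewrite setTI.
Qed.

(** Seen through [prependT], a point outside the box has its first coordinate outside the interval
    or the others outside the smaller box; both strips are null. *)
Lemma torus_box_null n : torus_measure R n (~` torus_box n) = 0%E.
Proof.
elim: n => [|n IH].
  have -> : torus_box 0 = setT by apply/seteqP; split => // x _; case.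
  by rewrite setCT measure0.
pose D : set (measurableTypeR R) := `[0, 2 * pi[%classic.
have mD : measurable D by exact: measurable_itv.
have mDC := measurableC mD.
have mB := measurableC (@measurable_torus_box n).
have E1 : (circle_measure R \x torus_measure R n)%E (~` D `*` setT) = 0%E.
  rewrite product_measure1E//.
  by rewrite /circle_measure /= /mfrestr /mrestr setICl measure0 mul0e.
have E2 : (circle_measure R \x torus_measure R n)%E (setT `*` ~` torus_box n) = 0%E.
  rewrite -[RHS](mule0 (circle_measure R setT)) -IH.
  exact: (product_measure1E (circle_measure R) (torus_measure R n) measurableT mB).
have E3 : (circle_measure R \x torus_measure R n)%E
    ((~` D `*` setT) `|` (setT `*` ~` torus_box n)) = 0%E.
  by apply: null_set_setU => //; exact: measurableX.
have mpre : measurable (@prependT R n @^-1` (~` torus_box n.+1)).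
  have := @measurable_prependT R n measurableT _ (measurableC (@measurable_torus_box n.+1)).
  by rewrite setTI.
apply: (subset_measure0 mpre _ _ E3); first by apply: measurableU; exact: measurableX.
move=> [a y] /= ay; have [aD|aD] := pselect (D a); last by left.
right; split => // yb; apply: ay => i.
have [->|i0] := eqVneq i ord0; first by move: aD; rewrite /D/= in_itv.
have [j ->] : exists j, i = lift ord0 j.
  by have := unliftP ord0 i; case=> [j ->|/eqP]; [exists j|rewrite (negPf i0)].
by rewrite tnthS; exact: yb.
Qed.

End torus_box.

Arguments torus_box {R} n.

(** * The L^2 closure of the trigonometric polynomials *)

Section dense.
Variables (R : realType) (n : nat).
Local Notation X := (n.-tuple (measurableTypeR R)).
Local Notation mu := (@torus_measure R n).
Implicit Types f g : X -> R[i].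
Implicit Types p q u v : X -> R.

(** The span of the characters, given inductively so that closure under products is an induction on
    both factors. *)
Inductive trig : (X -> R[i]) -> Prop :=
| trig_cisx m : trig (cisx m)
| trig_lin a f g : trig f -> trig g -> trig (fun x => a * f x + g x).

Lemma trig_L2 f : trig f -> torus_L2 f.
Proof.
by elim=> [m|a {}f g _ Lf _ Lg]; [exact: L2_cisx|exact: L2_lin].
Qed.

Lemma trig0 : trig (fun=> 0).
Proof.
have := trig_lin (-1) (trig_cisx 0) (trig_cisx 0).
by under eq_fun do rewrite mulN1r addNr.
Qed.

Lemma trigZ a f : trig f -> trig (fun x => a * f x).
Proof.
by move=> tf; have := trig_lin a tf trig0; under eq_fun do rewrite addr0.
Qed.

Lemma trigD f g : trig f -> trig g -> trig (fun x => f x + g x).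
Proof.
by move=> tf tg; have := trig_lin 1 tf tg; under eq_fun do rewrite mul1r.
Qed.

Lemma trigM f g : trig f -> trig g -> trig (fun x => f x * g x).
Proof.
move=> tf; elim: tf g => [m|a {}f f' _ IHf _ IHf'] g tg.
  elim: tg => [m'|a {}g g' _ IHg _ IHg'].
    by under eq_fun do rewrite cisxM; exact: trig_cisx.
  by under eq_fun do rewrite mulrDr mulrCA; exact: trig_lin.
under eq_fun do rewrite mulrDl -mulrA.
by apply: trig_lin; [exact: IHf|exact: IHf'].
Qed.

Definition rtrig p := trig (fun x => (p x)%:C%C).

Lemma rtrig_cst (c : R) : rtrig (fun=> c).
Proof.
have := trigZ c%:C%C (trig_cisx 0).
by under eq_fun do rewrite cisx0 mulr1.
Qed.

Lemma rtrigD p q : rtrig p -> rtrig q -> rtrig (fun x => p x + q x).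
Proof.
move=> tp tq; rewrite /rtrig; under eq_fun do rewrite rmorphD.
exact: trigD.
Qed.

Lemma rtrigM p q : rtrig p -> rtrig q -> rtrig (fun x => p x * q x).
Proof.
move=> tp tq; rewrite /rtrig; under eq_fun do rewrite rmorphM.
exact: trigM.
Qed.

Lemma rtrigZ c p : rtrig p -> rtrig (fun x => c * p x).
Proof. by move=> tp; apply: rtrigM => //; exact: rtrig_cst. Qed.

Lemma rtrigB p q : rtrig p -> rtrig q -> rtrig (fun x => p x - q x).
Proof.
move=> tp tq; under eq_fun do rewrite -mulN1r.
by apply: rtrigD => //; exact: rtrigZ.
Qed.

Lemma rtrigX p k : rtrig p -> rtrig (fun x => p x ^+ k).
Proof.
move=> tp; elim: k => [|k IH]; first exact: rtrig_cst.
by under eq_fun do rewrite exprS; exact: rtrigM.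
Qed.

Lemma rtrig_cutoff k p : rtrig p -> rtrig (fun x => cutoff k (p x)).
Proof.
move=> tp; apply: rtrigX; apply: rtrigB; first exact: rtrig_cst.
exact: rtrigX.
Qed.

Lemma phase_delta i (x : X) : phase (delta_mx 0 i) x = tnth x i.
Proof.
rewrite /phase (bigD1 i)//= mxE !eqxx mul1r big1 ?addr0// => j ji.
by rewrite mxE (negPf ji) andbF mul0r.
Qed.

Lemma rtrig_cos i : rtrig (fun x => cos (tnth x i)).
Proof.
have := trigZ (2^-1)%:C%C (trigD (trig_cisx (delta_mx 0 i)) (trig_cisx (- delta_mx 0 i))).
congr trig; apply/funext => x.
rewrite /cisx phaseN phase_delta cosN sinN; simpc.
by congr Complex; field.
Qed.

Lemma rtrig_sin i : rtrig (fun x => sin (tnth x i)).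
Proof.
(* Euler: sin x = -(i/2)(exp(ix) - exp(-ix)). *)
have := trigZ (Complex 0 (- 2^-1))
  (trig_lin (-1) (trig_cisx (- delta_mx 0 i)) (trig_cisx (delta_mx 0 i))).
congr trig; apply/funext => x.
rewrite /cisx phaseN phase_delta cosN sinN mulN1r; simpc.
by congr Complex; field.
Qed.

Lemma L2_real u (G : X -> R) : measurable_fun setT u ->
  mu.-integrable setT (EFin \o G) -> (forall x, u x ^+ 2 <= G x) ->
  torus_L2 (fun x => (u x)%:C%C).
Proof.
move=> mu_ iG uG; apply: (L2_dom (G := G)) => //.
by move=> x; rewrite sqr_normcE/= expr0n addr0.
Qed.

(** Dominated convergence for (u - u_k)^2 with majorant 4G^2; the bound |u| <= G is inherited from
    the u_k. *)
Lemma dominated_L2 (u_ : nat -> X -> R) u (G : X -> R) :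
  (forall k, measurable_fun setT (u_ k)) -> measurable_fun setT u ->
  (forall x, u_ k x @[k --> \oo] --> u x) ->
  measurable_fun setT G ->
  mu.-integrable setT (EFin \o (fun x => G x ^+ 2)) ->
  (forall k x, `|u_ k x| <= G x) ->
  L2norm (fun x => (u x)%:C%C - (u_ k x)%:C%C) @[k --> \oo] --> (0 : R).
Proof.
move=> mu_ mu' cv mG iG bnd.
have bndu x : `|u x| <= G x.
  by apply: (cvgr_to_le (cvg_norm (cv x))); exact: nearW.
have nsqE k : nsq (fun x => (u x)%:C%C - (u_ k x)%:C%C) =
    fine (\int[mu]_x ((u x - u_ k x) ^+ 2)%:E)%E.
  rewrite /nsq /Rintegral; congr fine; apply: eq_integral => x _.
  by rewrite -rmorphB sqr_normcE/= expr0n addr0.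
have [_ _ H] : [/\ mu.-integrable setT (fun _ : X => 0%E),
    [sequence \int[mu]_x (`|((u x - u_ k x) ^+ 2)%:E - 0|)]_k @ \oo --> 0%E &
    [sequence \int[mu]_x ((u x - u_ k x) ^+ 2)%:E]_k @ \oo -->
      (\int[mu]_x 0)%E]%E.
  apply: (@dominated_convergence _ _ _ mu setT measurableT
    (fun k x => ((u x - u_ k x) ^+ 2)%:E) (fun=> 0%E) (fun x => (4 * G x ^+ 2)%:E)) => //.
  - move=> k; apply/measurable_EFinP; apply: measurable_funX.
    exact: measurable_funB.
  - apply: aeW => x _; apply: cvg_EFin; first exact: nearW.
    have Z : (u x - u_ k x) @[k --> \oo] --> u x - u x.
      by apply: cvgB; [exact: cvg_cst|exact: cv].
    rewrite /comp/=; under eq_fun do rewrite expr2.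
    by have := cvgM Z Z; rewrite subrr mulr0; exact.
  - exact: integrable_RZ.
  - apply: aeW => x k _; rewrite lee_fin ger0_norm ?sqr_ge0//.
    have := bnd k x; have := bndu x; rewrite !ler_norml => /andP[a1 a2] /andP[b1 b2].
    by nra.
rewrite integral0 in H.
have H' : nsq (fun x => (u x)%:C%C - (u_ k x)%:C%C) @[k --> \oo] --> (0 : R).
  under eq_fun do rewrite nsqE.
  exact: (fine_cvg H).
rewrite -[X in _ --> X]sqrtr0; apply: (@continuous_cvg _ _ _ _ _ _ (@Num.sqrt R)) => //.
exact: sqrt_continuous.
Qed.

(** Membership of a single function in the L^2 closure of the trigonometric polynomials. *)
Definition dense f := torus_L2 f /\
  forall e : R, 0 < e -> exists2 p, trig p & L2norm (fun x => f x - p x) < e.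

Lemma dense_trig f : trig f -> dense f.
Proof.
move=> tf; split; first exact: trig_L2.
move=> e e0; exists f => //; under eq_fun do rewrite subrr.
by rewrite L2norm0.
Qed.

Lemma dense_closed f : torus_L2 f ->
  (forall e : R, 0 < e -> exists2 g, dense g & L2norm (fun x => f x - g x) < e) ->
  dense f.
Proof.
move=> Lf H; split => // e e0.
have e20 : 0 < e / 2 by rewrite divr_gt0.
have [g [Lg /(_ _ e20)[p tp gp]] fg] := H _ e20.
exists p => //; rewrite (le_lt_trans (L2norm_dist_triangle Lf Lg (trig_L2 tp)))//.
by rewrite [ltRHS](splitr e) ltrD.
Qed.

Lemma dense_lin a f g : dense f -> dense g -> dense (fun x => a * f x + g x).
Proof.
move=> [Lf Hf] [Lg Hg]; split; first exact: L2_lin.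
(* The summand 1 keeps the divisor positive when a = 0. *)
move=> e e0; pose A := Normc.normc a + 1.
have A0 : 0 < A by rewrite ltr_wpDl// normc_ge0.
have e20 : 0 < e / 2 by rewrite divr_gt0.
have [p tp fp] := Hf _ (divr_gt0 e20 A0).
have [q tq gq] := Hg _ e20.
exists (fun x => a * p x + q x); first exact: trig_lin.
have Lfp := L2_B Lf (trig_L2 tp); have Lgq := L2_B Lg (trig_L2 tq).
rewrite (_ : (fun x => _) = fun x => a * (f x - p x) + (g x - q x)); last first.
  by apply/funext => x; ring.
rewrite (le_lt_trans (L2norm_triangle (L2_Z a Lfp) Lgq))// L2normZ//.
rewrite [ltRHS](splitr e) ler_ltD//.
rewrite ltr_pdivlMr// in fp; rewrite (le_trans _ (ltW fp))// mulrC.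
by rewrite ler_wpM2l ?L2norm_ge0// lerDl.
Qed.

Definition rdense u := dense (fun x => (u x)%:C%C).

(** The one limit theorem behind every extension step below: cutoffs to indicators, finite to
    countable unions, simple functions to measurable ones. *)
Lemma rdense_lim (u_ : nat -> X -> R) u (G : X -> R) :
  (forall k, rdense (u_ k)) ->
  (forall x, u_ k x @[k --> \oo] --> u x) ->
  measurable_fun setT G ->
  mu.-integrable setT (EFin \o (fun x => G x ^+ 2)) ->
  (forall k x, `|u_ k x| <= G x) -> rdense u.
Proof.
move=> du cv mG iG bnd.
have mu_ k : measurable_fun setT (u_ k) by have [[]] := du k.
have mu' : measurable_fun setT u.
  exact: (measurable_fun_cvg mu_ (fun x _ => cv x)).
have bndu x : `|u x| <= G x.
  by apply: (cvgr_to_le (cvg_norm (cv x))); exact: nearW.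
apply: dense_closed.
  apply: (L2_real mu' iG) => x; rewrite -[leLHS]real_normK ?num_real//.
  by rewrite lerXn2r ?nnegrE// (le_trans (normr_ge0 _) (bndu x)).
move=> e e0.
have /cvgrPdist_lt/(_ _ e0)[k _ /(_ k (leqnn k))] := dominated_L2 mu_ mu' cv mG iG bnd.
rewrite /= sub0r normrN ger0_norm ?L2norm_ge0// => H.
by exists (fun x => (u_ k x)%:C%C) => //; exact: du.
Qed.

Lemma rdense_lin c u v : rdense u -> rdense v -> rdense (fun x => c * u x + v x).
Proof.
move=> du dv; have := dense_lin c%:C%C du dv; congr dense.
by apply/funext => x; rewrite rmorphD rmorphM.
Qed.

Lemma rdense_cst c : rdense (fun=> c).
Proof. by apply: dense_trig; exact: rtrig_cst. Qed.

Lemma rdense_sum (I : Type) (s : seq I) (u : I -> X -> R) :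
  (forall i, rdense (u i)) -> rdense (fun x => \sum_(i <- s) u i x).
Proof.
move=> du; elim: s => [|i s IH].
  by under eq_fun do rewrite big_nil; exact: rdense_cst.
under eq_fun do rewrite big_cons -[u i _]mul1r.
exact: rdense_lin.
Qed.

(** The pi-system of the Dynkin argument. Pointwise limits of approximants with values in [0, 1],
    rather than L^2 limits, make it stable under intersection: multiply the approximants. *)
Definition trig_limit_set (A : set X) := exists p : nat -> X -> R,
  [/\ forall k, rtrig (p k), forall k x, 0 <= p k x <= 1 &
      forall x, p k x @[k --> \oo] --> (\1_A x : R)].

(** An affine rescaling [h] of g takes values in [0, 1] and moves the threshold c to 1/2, where
    [cutoff] jumps. *)
Lemma trig_limit_set_lt (g : X -> R) (c M : R) : rtrig g -> (forall x, `|g x| <= M) ->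
  trig_limit_set [set x | g x < c].
Proof.
move=> tg gM; pose B := `|M| + `|c| + 1.
have B0 : 0 < B by rewrite ltr_wpDl// addr_ge0.
pose h x := 2^-1 + (2 * B)^-1 * (g x - c).
have th : rtrig h.
  apply: rtrigD; first exact: rtrig_cst.
  by apply: rtrigZ; apply: rtrigB => //; exact: rtrig_cst.
have h01 x : 0 <= h x <= 1.
  have : `|g x - c| <= B.
    rewrite (le_trans (ler_normB _ _))// /B -addrA lerD//.
      exact: le_trans (gM x) (ler_norm _).
    by rewrite lerDl.
  rewrite ler_norml => /andP[h1 h2]; rewrite /h.
  have B20 : 0 < 2 * B by rewrite mulr_gt0.
  have -> : 2^-1 = (2 * B)^-1 * B by field; rewrite gt_eqF.
  rewrite -mulrDr mulr_ge0/= ?invr_ge0 ?(ltW B20)//; last by lra.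
  by rewrite mulrC ler_pdivrMr//; lra.
exists (fun k x => cutoff k (h x)); split.
- by move=> k; exact: rtrig_cutoff.
- by move=> k x; exact: cutoff_itv.
- move=> x; have := cutoff_cvg (h01 x); congr (_ --> _); rewrite indicE; congr (_ %:R).
  congr nat_of_bool; rewrite /h -[ltRHS]addr0 ltrD2l pmulr_rlt0 ?subr_lt0 ?invr_gt0 ?mulr_gt0//.
  by apply/idP/idP => [gc|/set_mem]//; apply/mem_set.
Qed.

Lemma trig_limit_setI : setI_closed trig_limit_set.
Proof.
move=> A B [p [tp p01 pA]] [q [tq q01 qB]].
exists (fun k x => p k x * q k x); split.
- by move=> k; exact: rtrigM.
- move=> k x; have /andP[a0 a1] := p01 k x; have /andP[b0 b1] := q01 k x.
  by rewrite mulr_ge0//= mulr_ile1.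
- by move=> x; rewrite indicI; apply: cvgM.
Qed.

Lemma rdense_trig_limit_set A : trig_limit_set A -> rdense (\1_A).
Proof.
move=> [p [tp p01 pA]]; apply: (@rdense_lim p _ (fun=> 1)) => //.
- by move=> k; apply: dense_trig; exact: tp.
- by under eq_fun do rewrite expr1n; exact: finite_measure_integrable_cst.
- by move=> k x; have /andP[a0 a1] := p01 k x; rewrite ger0_norm.
Qed.

(** Pi-lambda: the sets whose indicator lies in the closure form a Dynkin system. *)
Lemma rdense_sigma A : <<s trig_limit_set >> A -> rdense (\1_A).
Proof.
rewrite -(setI_closed_g_dynkin_g_sigma_algebra trig_limit_setI).
apply: (@smallest_sub _ _ _ [set B | rdense (\1_B)]); last first.
  exact: rdense_trig_limit_set.
split => [|B dB|F tF dF] /=.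
- by rewrite indicT; exact: rdense_cst.
- have := rdense_lin (-1) dB (rdense_cst 1); congr rdense; apply/funext => x.
  rewrite !indicE in_setC mulN1r.
  by case: (x \in B); rewrite ?addNr// oppr0 add0r.
(* By disjointness these partial sums only take the values 0 and 1 and are eventually constant at
   each point, so the constant 1 dominates them. *)
- pose u_ k x : R := \sum_(i <- iota 0 k) \1_(F i) x.
  have uE k j x : F j x -> u_ k x = (j < k)%N%:R.
    move=> Fjx; have F0 i : i != j -> \1_(F i) x = 0 :> R.
      move=> ij; rewrite indicE memNset// => Fix.
      by move: ij; rewrite (tF i j I I) ?eqxx//; exists x.
    rewrite /u_; case: ltnP => jk.
      rewrite (bigD1_seq j) ?iota_uniq ?mem_iota//= big1 => [|i /F0//].
      by rewrite indicE mem_set// addr0.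
    rewrite big_seq big1// => i; rewrite mem_iota add0n => /andP[_ ik].
    by apply: F0; rewrite ltn_eqF// (leq_trans ik).
  have uN k x : ~ (\bigcup_i F i) x -> u_ k x = 0.
    move=> Fx; rewrite /u_ big1// => i _; rewrite indicE memNset// => Fix.
    by apply: Fx; exists i.
  apply: (@rdense_lim u_ _ (fun=> 1)) => //.
  + by move=> k; exact: rdense_sum.
  + move=> x; rewrite indicE; have [[j _ Fjx]|Fx] := pselect ((\bigcup_i F i) x).
      rewrite mem_set; last by exists j.
      apply: cvg_near_cst; exists j.+1 => // k /= jk.
      by rewrite (uE k j x Fjx) jk.
    by rewrite memNset//; apply: cvg_near_cst; apply: nearW => k; rewrite uN.
  + by under eq_fun do rewrite expr1n; exact: finite_measure_integrable_cst.
  + move=> k x; have [[j _ Fjx]|Fx] := pselect ((\bigcup_i F i) x).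
      by rewrite (uE k j x Fjx) ger0_norm// lern1 leq_b1.
    by rewrite uN// normr0.
Qed.

Lemma sigma_setC A : <<s trig_limit_set >> A -> <<s trig_limit_set >> (~` A).
Proof.
by have [_ + _] := smallest_sigma_algebra setT trig_limit_set => /[apply]; rewrite setTD.
Qed.

(* On [0, 2 pi[ the condition x < a is read off the sign of sin x and the
   position of cos x relative to cos a. *)
Lemma sigma_lt_coord i (a : R) : exists2 B, <<s trig_limit_set >> B &
  [set x | tnth x i < a] `&` torus_box n = B `&` torus_box n.
Proof.
have sG (g : X -> R) c : rtrig g -> (forall x, `|g x| <= 1) ->
    <<s trig_limit_set >> [set x | g x < c].
  by move=> tg g1; apply: sub_sigma_algebra; exact: trig_limit_set_lt tg g1.
have s0 : <<s trig_limit_set >> set0.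
  by have [] := smallest_sigma_algebra setT trig_limit_set.
have ssin := sG _ 0 (rtrig_sin i) (fun x => sin_max _).
have scos c := sG _ c (rtrig_cos i) (fun x => cos_max _).
have sncos c : <<s trig_limit_set >> [set x : X | -1 * cos (tnth x i) < c].
  by apply: (sG _ c (rtrigZ (-1) (rtrig_cos i))) => x; rewrite mulN1r normrN cos_max.
have sI A B : <<s trig_limit_set >> A ->
    <<s trig_limit_set >> B -> <<s trig_limit_set >> (A `&` B).
  exact: (@measurableI _ (g_sigma_algebraType trig_limit_set)).
have [a0|a0] := leP a 0.
  exists set0 => //; rewrite set0I -subset0 => x [/= xa /(_ i)/andP[x0 _]].
  by move: (lt_le_trans xa a0); rewrite ltNge x0.
have [a2|a2] := leP (2 * pi) a.
  exists setT; first by have := sigma_setC s0; rewrite setC0.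
  rewrite setTI; apply/setIidPr => x xb /=.
  by have /andP[_ x2] := xb i; rewrite (lt_le_trans x2).
have sinP (y : R) : 0 <= y < 2 * pi -> (sin y < 0) = (pi < y).
  move=> /andP[y0 y2]; case: (ltP pi y) => ypi.
    have : 0 < sin (y - pi) by apply: sin_gt0_pi; lra.
    by rewrite sinB cospi sinpi; lra.
  by apply/negbTE; rewrite -leNgt sin_ge0_pi// y0.
(* The reflection brings the second half of the circle into [0, pi], where cos is strictly
   decreasing. *)
have cosE (y : R) : cos y = cos (2 * pi - y).
  by rewrite -cosN -(cos_periodz 1) mul1r.
have mono := @ltr_cos R.
have [api|api] := leP a pi.
(* For a <= pi: x < a iff x lies in the first half and cos x > cos a. The sign change writes the
   last condition as a sublevel set. *)
- exists (~` [set x | sin (tnth x i) < 0] `&` [set x | -1 * cos (tnth x i) < - cos a]).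
    by apply: sI => //; exact: sigma_setC.
  apply/seteqP; split => x [/= H xb]; split => //; have xbi := xb i;
    have /andP[x0 x2] := xbi.
  + split; first by rewrite sinP//; lra.
    by rewrite mulN1r ltrN2 mono// in_itv/= ; apply/andP; split; lra.
  + have [/negP + +] := H; rewrite sinP// -leNgt => xpi.
    by rewrite mulN1r ltrN2 mono// in_itv/=; apply/andP; split; lra.
(* For a > pi the complement is simpler: x >= a iff x lies in the second half and cos x >= cos a. *)
- exists (~` ([set x | sin (tnth x i) < 0] `&` ~` [set x | cos (tnth x i) < cos a])).
    by apply: sigma_setC; apply: sI => //; exact: sigma_setC.
  apply/seteqP; split => x [/= H xb]; split => //; have xbi := xb i;
    have /andP[x0 x2] := xbi.
  + move=> [+]; rewrite sinP// => xpi; apply.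
    rewrite (cosE (tnth x i)) (cosE a) mono ?in_itv/=; lra.
  + rewrite ltNge; apply/negP => ax; apply: H; rewrite sinP//; split; first lra.
    rewrite (cosE (tnth x i)) (cosE a); apply/negP; rewrite -leNgt leNgt.
    by rewrite mono ?in_itv/=; lra.
Qed.

(** The sets that agree on the box with some generated set form a sigma-algebra; it contains the
    coordinate preimages of rays, hence of all Borel sets of the line, and these generate. *)
Lemma sigma_box A : measurable A -> exists2 B, <<s trig_limit_set >> B &
  A `&` torus_box n = B `&` torus_box n.
Proof.
pose S := [set A | exists2 B, <<s trig_limit_set >> B &
  A `&` torus_box n = B `&` torus_box n].
have [s0 _ sU] := smallest_sigma_algebra setT trig_limit_set.
have SC C : S C -> S (~` C).
  move=> [B sB AB]; exists (~` B); first exact: sigma_setC.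
  apply/seteqP; split => x [/= Cx xb]; split => // Bx; apply: Cx.
    by have : (B `&` torus_box n) x by []; rewrite -AB => -[].
  by have : (C `&` torus_box n) x by []; rewrite AB => -[].
have SU (F : (set X)^nat) : (forall k, S (F k)) -> S (\bigcup_k F k).
  move=> SF; have /choice[G HG] k : exists B, <<s trig_limit_set >> B /\
      F k `&` torus_box n = B `&` torus_box n.
    by have [B sB FB] := SF k; exists B.
  exists (\bigcup_k G k); first by apply: sU => k; case: (HG k).
  by rewrite !setI_bigcupl; apply: eq_bigcupr => k _; case: (HG k).
have S0 : S set0 by exists set0.
have Srays i (Y : set (measurableTypeR R)) : measurable Y ->
    S (@tnth _ (measurableTypeR R) ^~ i @^-1` Y).
  have -> : @measurable _ (measurableTypeR R) = (@RGenInftyO.G R).-sigma.-measurable.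
    exact: RGenInftyO.measurableE.
  apply: (@smallest_sub _ _ _ [set Y | S (@tnth n (measurableTypeR R) ^~ i @^-1` Y)]).
    split => [|B SB|F SF] /=.
    - by rewrite preimage_set0.
    - by rewrite setTD preimage_setC; exact: SC.
    - by rewrite preimage_bigcup; exact: SU.
  by move=> _ [a ->] /=; have [B sB HB] := sigma_lt_coord i a; exists B.
apply: (@smallest_sub _ _ _ S); first by split => // C SC'; rewrite setTD; exact: SC.
move=> C; rewrite -bigcup_seq => -[i /= _ [Y mY <-]].
by rewrite setTI; exact: Srays.
Qed.

(** A is exchanged for a generated set B with the same trace on the box, whose complement is
    null. *)
Lemma rdense_indic A : measurable A -> rdense (\1_A).
Proof.
move=> mA; have [B /rdense_sigma dB AB] := sigma_box mA.
apply: dense_closed.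
  apply: (@L2_real _ (fun=> 1)).
  - exact: measurable_indic.
  - exact: finite_measure_integrable_cst.
  - by move=> x; rewrite indicE; case: (_ \in _); rewrite ?expr1n// expr0n.
move=> e e0; exists (fun x => (\1_B x)%:C%C) => //.
rewrite L2eq_norm0//.
- apply: (@L2_real _ (fun=> 1)).
  + exact: measurable_indic.
  + exact: finite_measure_integrable_cst.
  + by move=> x; rewrite indicE; case: (_ \in _); rewrite ?expr1n// expr0n.
- by case: dB.
- exists (~` torus_box n); split.
  + exact: measurableC (@measurable_torus_box _ n).
  + exact: torus_box_null.
  + move=> x /= AxBx xb; apply: AxBx; rewrite !indicE; congr (_%:R%:C%C).
    congr nat_of_bool; apply/idP/idP => /set_mem xA; apply/mem_set.
      by have : (A `&` torus_box n) x by []; rewrite AB => -[].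
    by have : (B `&` torus_box n) x by []; rewrite -AB => -[].
Qed.

Import HBNNSimple.

Lemma rdense_nnsfun (h : {nnsfun X >-> R}) : rdense h.
Proof.
have : rdense (fun x => \sum_(y <- finmap.enum_fset (fset_set (range h)))
    (y * \1_(h @^-1` [set y]) x)).
  apply: rdense_sum => y.
  have := rdense_lin y (rdense_indic (measurable_sfunP h (measurable_set1 y)))
    (rdense_cst 0).
  by congr rdense; apply/funext => x; rewrite addr0.
congr rdense; apply/funext => x; rewrite [RHS]fimfunE fsbig_finite//.
Qed.

Lemma rdense_ge0 (u : X -> R) : measurable_fun setT u ->
  mu.-integrable setT (EFin \o (fun x => u x ^+ 2)) ->
  (forall x, 0 <= u x) -> rdense u.
Proof.
move=> mu_ iu u0.
have mEu : measurable_fun setT (EFin \o u) by exact/measurable_EFinP.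
pose h := nnsfun_approx measurableT mEu.
have hu x : h k x @[k --> \oo] --> u x.
  have := @cvg_nnsfun_approx _ _ _ _ measurableT _ mEu (fun x _ => u0 x : (0 <= (u x)%:E)%E) x I.
  by move/fine_cvg; exact.
have hle k x : h k x <= u x.
  rewrite -(cvg_lim _ (hu x))//; apply: nondecreasing_cvgn_le.
    by move=> a b ab; have /lefP := nd_nnsfun_approx measurableT mEu ab; exact.
  by apply/cvg_ex; eexists; exact: hu.
(* The increasing simple approximations are dominated by u itself. *)
apply: (@rdense_lim h u u) => //.
- by move=> k; exact: rdense_nnsfun.
- by move=> k x; rewrite ger0_norm ?hle//.
Qed.

Lemma rdense_L2 (u : X -> R) : measurable_fun setT u ->
  mu.-integrable setT (EFin \o (fun x => u x ^+ 2)) -> rdense u.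
Proof.
move=> mu_ iu.
have D (v : X -> R) : measurable_fun setT v ->
    (forall x, v x ^+ 2 = u x ^+ 2) -> rdense (fun x => Num.max (v x) 0).
  move=> mv vu; apply: rdense_ge0.
  - exact: measurable_maxr.
  - apply: le_integrable iu => //.
      by apply/measurable_EFinP; apply: measurable_funX; exact: measurable_maxr.
    move=> x _ /=; rewrite lee_fin !ger0_norm ?sqr_ge0// -vu.
    by case: (leP (v x) 0) => // _; rewrite expr0n sqr_ge0.
  - by move=> x; rewrite le_max lexx orbT.
have := rdense_lin (-1) (D (fun x => - u x) (measurable_funN mu_) (fun x => sqrrN (u x)))
  (D u mu_ (fun=> erefl)).
congr rdense; apply/funext => x; rewrite mulN1r.
by case: (leP (u x) 0) => u0; case: (leP (- u x) 0) => u1; lra.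
Qed.

Lemma dense_L2 f : torus_L2 f -> dense f.
Proof.
move=> Lf; have [mR mI _] := Lf.
have dom (v : X -> R) : measurable_fun setT v ->
    (forall x, v x ^+ 2 <= Normc.normc (f x) ^+ 2) -> rdense v.
  move=> mv vf; apply: rdense_L2 => //.
  apply: le_integrable (L2_integrable Lf) => //.
    by apply/measurable_EFinP; exact: measurable_funX.
  by move=> x _ /=; rewrite lee_fin !ger0_norm ?sqr_ge0.
have dR : rdense (fun x => complex.Re (f x)).
  by apply: dom => // x; rewrite sqr_normcE lerDl sqr_ge0.
have dI : rdense (fun x => complex.Im (f x)).
  by apply: dom => // x; rewrite sqr_normcE lerDr sqr_ge0.
have := dense_lin (Complex 0 1) dI dR; congr dense; apply/funext => x.
by case: (f x) => a b /=; simpc.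
Qed.

End dense.

(** * Eigenfunctions of the heat semigroup *)

Section wave.
Variables (R : realType) (n : nat) (m : 'rV[int]_n).
Implicit Types y v : 'rV[R]_n.

Definition dotz y : R := \sum_(i < n) (m 0 i)%:~R * y 0 i.

(** A family closed under partial derivatives: the i-th one multiplies the amplitude by m_i and
    advances the phase by pi/2. It contains the real and imaginary parts of the characters. *)
Definition wave (a c : R) y : R := a * cos (dotz y + c).

Lemma dotzD y y' : dotz (y + y') = dotz y + dotz y'.
Proof.
by rewrite /dotz -big_split; apply: eq_bigr => i _; rewrite mxE mulrDr.
Qed.

Lemma dotzZ_delta (h : R) i : dotz (h *: delta_mx 0 i) = (m 0 i)%:~R * h.
Proof.
rewrite /dotz (bigD1 i)//= !mxE !eqxx mulr1 big1 ?addr0// => j ji.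
by rewrite !mxE (negPf ji) andbF !mulr0.
Qed.

Lemma continuous_dotz : continuous dotz.
Proof.
rewrite /dotz; elim: (index_enum _) => [|i s IH].
  rewrite (_ : (fun y => _) = cst 0); first exact: cst_continuous.
  by apply/funext => y; rewrite big_nil.
rewrite (_ : (fun y => _) = (fun y : 'rV_n => (m 0 i)%:~R * y 0 i) +
  (fun y : 'rV_n => \sum_(i <- s) (m 0 i)%:~R * y 0 i)); last first.
  by apply/funext => y; rewrite big_cons.
move=> y; apply: continuousD; last exact: IH.
apply: (@continuousM _ _ (cst (m 0 i)%:~R)); first exact: cst_continuous.
exact: coord_continuous.
Qed.

Lemma continuous_wave a c : continuous (wave a c).
Proof.
move=> y; apply: (@continuousM _ _ (cst a)); first exact: cst_continuous.
apply: (@continuous_comp _ _ _ (fun y => dotz y + c) (@cos R)); last exact: continuous_cos.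
apply: (@continuousD _ _ _ dotz (cst c)); first exact: continuous_dotz.
exact: cst_continuous.
Qed.

Lemma is_derive_wave a c i y :
  is_derive y (delta_mx 0 i) (wave a c) (wave (a * (m 0 i)%:~R) (c + pi / 2) y).
Proof.
pose phi (h : R) := a * cos ((m 0 i)%:~R * h + (dotz y + c)).
have phiE h : phi h = wave a c (h *: delta_mx 0 i + y).
  by rewrite /phi /wave dotzD dotzZ_delta addrA.
have H : is_derive (0 : R) 1 phi (wave (a * (m 0 i)%:~R) (c + pi / 2) y).
  rewrite [X in is_derive _ _ X](_ : _ = a \*:
    (cos \o (fun h => (m 0 i)%:~R * h + (dotz y + c)))); last exact/funext.
  have K := @is_derive1_comp _ (@cos R) (fun h => (m 0 i)%:~R * h + (dotz y + c)) _ _ _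
    (is_derive_cos _) (is_derive_lin (m 0 i)%:~R (dotz y + c) 0).
  apply: is_derive_eq.
  by rewrite /wave mulr0 add0r addrA cosDpihalf -mulrA [X in a *: X]mulrC.
(* Along the direction i the difference quotients are those of the one-variable function [phi] at
   0. *)
have E : (fun h => h^-1 *: ((wave a c \o shift y) (h *: delta_mx 0 i) - wave a c y)) =
    (fun h => h^-1 *: ((phi \o shift 0) (h *: 1) - phi 0)).
  apply/funext => h /=; rewrite addr0 -[h *: 1]/(h * 1) mulr1 !phiE scale0r add0r.
  by congr (_ *: _).
have [dphi Dphi] := H.
split; first by rewrite /derivable E.
by rewrite -Dphi /derive E.
Qed.

Lemma partial_wave a c i : partial i (wave a c) = wave (a * (m 0 i)%:~R) (c + pi / 2).
Proof.
by apply/funext => y; rewrite /partial; have [_ ->] := is_derive_wave a c i y.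
Qed.

Lemma Ck_wave k a c : Ck k (wave a c).
Proof.
elim: k a c => [|k IH] a c /=; first exact: continuous_wave.
split=> [|i]; first exact: continuous_wave.
split; last by rewrite partial_wave.
by move=> y; have [] := is_derive_wave a c i y.
Qed.

Lemma wave_pi a c y : wave a (c + pi / 2 + pi / 2) y = - wave a c y.
Proof.
by rewrite /wave addrA addrA cosDpihalf sinDpihalf mulrN.
Qed.

Lemma wave_period a c i y :
  wave a c (y + (2 * pi) *: delta_mx 0 i) = wave a c y.
Proof. by rewrite /wave dotzD dotzZ_delta -addrA addrCA cos_periodz. Qed.

Let kappa := (Num.sqrt (torus_mass R n))^-1.

Lemma Re_uchar : (fun y => complex.Re (uchar m y)) = wave kappa 0.
Proof. by apply/funext => y; rewrite /uchar complexReM /= mul0r subr0 /wave addr0. Qed.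

Lemma Im_uchar : (fun y => complex.Im (uchar m y)) = wave kappa (- (pi / 2)).
Proof.
by apply/funext => y; rewrite /uchar complexImM /= mul0r addr0 /wave cosBpihalf.
Qed.

Lemma torus_smooth_uchar : torus_smooth (uchar m : 'rV[R]_n -> R[i]).
Proof.
split=> [k|k|i y].
- by rewrite Re_uchar; exact: Ck_wave.
- by rewrite Im_uchar; exact: Ck_wave.
- have E u : complex.Re (uchar m u) = wave kappa 0 u by rewrite -Re_uchar.
  have F u : complex.Im (uchar m u) = wave kappa (- (pi / 2)) u by rewrite -Im_uchar.
  apply/eqP; rewrite eq_complex E F [complex.Re (uchar m y)]E [complex.Im (uchar m y)]F.
  by rewrite !wave_period !eqxx.
Qed.

Lemma laplacian_uchar y : laplacian (uchar m) y = (- normsq R m)%:C%C * uchar m y.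
Proof.
have D c i : partial i (partial i (wave kappa c)) y =
    - (m 0 i)%:~R ^+ 2 * wave kappa c y.
  by rewrite !partial_wave wave_pi /wave; ring.
have S c : \sum_(i < n) partial i (partial i (wave kappa c)) y =
    - normsq R m * wave kappa c y.
  by rewrite (eq_bigr _ (fun i _ => D c i)) -mulr_suml sumrN.
have ER : complex.Re (uchar m y) = wave kappa 0 y by rewrite -Re_uchar.
have EI : complex.Im (uchar m y) = wave kappa (- (pi / 2)) y by rewrite -Im_uchar.
transitivity (Complex (- normsq R m * wave kappa 0 y)
    (- normsq R m * wave kappa (- (pi / 2)) y)).
  by rewrite -!S -Re_uchar -Im_uchar.
by rewrite -ER -EI; case: (uchar m y) => p q /=; simpc.
Qed.

Lemma torus_laplacian_char : torus_laplacian (@torus_char R n m)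
  (fun x => (- normsq R m)%:C%C * torus_char m x).
Proof.
have L := @L2_torus_char R n m.
split => //; first exact: L2_Z.
(* The character is smooth, so a constant sequence witnesses membership in the closed graph. *)
exists (fun=> uchar m); split.
- by move=> _; exact: torus_smooth_uchar.
- by under eq_fun do under eq_fun do rewrite subrr; rewrite L2norm0; exact: cvg_cst.
- under eq_fun do under eq_fun do rewrite /on_torus laplacian_uchar subrr.
  by rewrite L2norm0; exact: cvg_cst.
Qed.

End wave.

(** * From eigenfunctions of the generator to eigenfunctions of the semigroup *)

Section semigroup.
Variables (R : realType) (n : nat).
Local Notation X := (n.-tuple (measurableTypeR R)).
Variable S : R -> (X -> R[i]) -> X -> R[i].
Hypothesis semiS : C0_semigroup S.

Lemma C0_operator t : 0 <= t -> L2_operator (S t).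
Proof.
move=> t0; split => [f Lf|a f g Lf Lg|].
- exact: C0_L2.
- exact: C0_linear.
- by have [M [w H]] := C0_bounded semiS; exists (M * expR (w * t)) => f; exact: H.
Qed.

(** From 1 - x <= exp(-x) <= 1/(1 + x), as 1/(1 + x) - 1 + x = x^2/(1 + x). *)
Lemma expRN_taylor1 (x : R) : 0 <= x -> `|expR (- x) - 1 + x| <= x ^+ 2.
Proof.
move=> x0; have h1 : 1 - x <= expR (- x) by exact: expR_ge1Dx.
have h2 : (1 + x) * expR (- x) <= 1.
  have := ler_wpM2r (expR_ge0 (- x)) (expR_ge1Dx x).
  by rewrite -expRD subrr expR0.
by rewrite ger0_norm; nra.
Qed.

Section eigenfunction.
Variables (f : X -> R[i]) (lam : R).
Hypothesis lam0 : 0 <= lam.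
Hypothesis genf : generator S f (fun x => (- lam)%:C%C * f x).

Let Lf : torus_L2 f. Proof. by case: genf. Qed.

Let Ef (t : R) : X -> R[i] := fun x => (expR (- lam * t))%:C%C * f x.

Let LE t : torus_L2 (Ef t). Proof. exact: L2_Z. Qed.

Let d t := L2norm (fun x => S t f x - Ef t x).

(* One step costs o(h): both S h f and exp (- lam h) f are f - h lam f + o(h). *)
Lemma eigen_step (e : R) : 0 < e ->
  \forall h \near 0^'+, d h <= h * e.
Proof.
move=> e0; have [_ Lg cv] := genf.
have K0 : 0 < lam ^+ 2 * L2norm f + 1 by rewrite ltr_wpDl// mulr_ge0 ?sqr_ge0 ?L2norm_ge0.
have e20 : 0 < e / 2 by rewrite divr_gt0.
have /cvgrPdist_lt/(_ _ e20) cv2 := cv.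
near=> h.
have h0 : 0 < h by near: h; exact: nbhs_right_gt.
have Lh : torus_L2 (S h f) by apply: C0_L2 => //; exact: ltW.
pose G := fun x => (h^-1)%:C%C * (S h f x - f x) - (- lam)%:C%C * f x.
have LG : torus_L2 G by apply: L2_B => //; apply: L2_Z; exact: L2_B.
have Gh : L2norm G < e / 2.
  rewrite -[ltLHS]ger0_norm ?L2norm_ge0// -[L2norm G]subr0 distrC.
  by rewrite /G; near: h; exact: cv2.
have hs : h * (lam ^+ 2 * L2norm f) <= e / 2.
  have : h < e / 2 / (lam ^+ 2 * L2norm f + 1).
    by near: h; apply: nbhs_right_lt; rewrite !divr_gt0.
  rewrite ltr_pdivlMr// => H; apply: le_trans (ltW H).
  by rewrite ler_wpM2l ?(ltW h0)// lerDl.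
(* Minus the Taylor remainder of exp(-lam h). The defect is hG + cf with G the error of the
   difference quotient; each summand costs at most h e/2. *)
pose c := 1 - lam * h - expR (- lam * h).
have -> : d h = L2norm (fun x => h%:C%C * G x + c%:C%C * f x).
  rewrite /d; congr L2norm; apply/funext => x; rewrite /G /Ef /c.
  have hC : h%:C%C * (h^-1)%:C%C = 1 :> R[i] by rewrite -rmorphM mulfV// gt_eqF.
  rewrite mulrBr [h%:C%C * (_ * _)]mulrA hC mul1r !rmorphB !rmorphM !rmorphN rmorph1.
  by ring.
rewrite (le_trans (L2norm_triangle (L2_Z _ LG) (L2_Z _ Lf)))// !L2normZ//.
have nr (r : R) : Normc.normc r%:C%C = `|r| by rewrite /= expr0n addr0 sqrtr_sqr.
rewrite !nr ger0_norm ?(ltW h0)// [in leRHS](splitr e) mulrDr lerD//.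
  by rewrite ler_wpM2l ?(ltW h0)// ltW.
have hl : 0 <= lam * h by rewrite mulr_ge0// ltW.
apply: (@le_trans _ _ ((lam * h) ^+ 2 * L2norm f)).
  rewrite ler_wpM2r ?L2norm_ge0// -normrN (_ : - c = expR (- (lam * h)) - 1 + lam * h).
    exact: expRN_taylor1.
  by rewrite /c mulNr; ring.
rewrite (_ : _ * L2norm f = h * (h * (lam ^+ 2 * L2norm f))); last by ring.
by rewrite ler_wpM2l ?(ltW h0).
Unshelve. all: by end_near. Qed.

Lemma eigen_defect0 : d 0 = 0.
Proof.
apply: L2eq_norm0 => //; first exact: C0_L2.
have := C0_zero semiS Lf; apply: filterS => x ->.
by rewrite /Ef mulr0 expR0 mul1r.
Qed.

(** Telescoping: write S h f = cf + g with g the one-step defect and apply S(kh). The part cf is the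
    induction hypothesis, as |c| <= 1, and g adds at most C d(h). *)
Lemma eigen_iter (C h : R) k : 0 <= h -> 0 <= C ->
  (forall j, (j < k)%N -> forall g, torus_L2 g -> L2norm (S (j%:R * h) g) <= C * L2norm g) ->
  d (k%:R * h) <= k%:R * (C * d h).
Proof.
move=> h0 C0; elim: k => [|k IH] HC.
  by rewrite !mul0r eigen_defect0.
have kh0 : 0 <= k%:R * h by rewrite mulr_ge0.
have LSh := C0_L2 semiS h0 Lf; have LSkh := C0_L2 semiS kh0 Lf.
have LSS := C0_L2 semiS kh0 LSh.
have k1E : k.+1%:R * h = k%:R * h + h by rewrite -natr1 mulrDl mul1r.
have k1h0 : 0 <= k.+1%:R * h by rewrite mulr_ge0.
pose c : R[i] := (expR (- lam * h))%:C%C; pose g := fun x => S h f x - Ef h x.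
have Lg : torus_L2 g by exact: L2_B.
have LSg := C0_L2 semiS kh0 Lg.
have ShE : S h f = fun x => c * f x + g x.
  by apply/funext => x; rewrite /g /Ef addrC subrK.
pose w := fun x => c * S (k%:R * h) f x + S (k%:R * h) g x.
have Lw : torus_L2 w by exact: L2_lin.
(* The semigroup law and linearity hold almost everywhere only; each enters the triangle inequality
   as a term of norm 0. *)
have e1 : L2norm (fun x => S (k.+1%:R * h) f x - S (k%:R * h) (S h f) x) = 0.
  apply: L2eq_norm0 => //; first exact: C0_L2.
  by rewrite k1E; exact: C0_add.
have e2 : L2norm (fun x => S (k%:R * h) (S h f) x - w x) = 0.
  apply: L2eq_norm0 => //.
  by rewrite {1}ShE; exact: C0_linear.
have LS1 := C0_L2 semiS k1h0 Lf.
rewrite /d (le_trans (L2norm_dist_triangle LS1 LSS (LE _)))// e1 add0r.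
rewrite (le_trans (L2norm_dist_triangle LSS Lw (LE _)))// e2 add0r.
rewrite (_ : (fun x => _) = fun x =>
    c * (S (k%:R * h) f x - Ef (k%:R * h) x) + S (k%:R * h) g x); last first.
  apply/funext => x; rewrite /w /Ef k1E mulrDr expRD rmorphM -/c.
  by ring.
rewrite (le_trans (L2norm_triangle (L2_Z _ (L2_B LSkh (LE _))) LSg))//.
rewrite L2normZ; last exact: L2_B.
rewrite -natr1 mulrDl mul1r lerD//; last exact: HC.
rewrite -[leRHS]mul1r ler_pM ?normc_ge0 ?L2norm_ge0//.
  rewrite /c /= expr0n addr0 sqrtr_sqr ger0_norm ?expR_ge0//.
  by rewrite -expR0 ler_expR mulNr oppr_le0 mulr_ge0.
by apply: IH => j jk; apply: HC; rewrite ltnS ltnW.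
Qed.

Lemma eigen_semigroup t : 0 <= t -> d t = 0.
Proof.
rewrite le_eqVlt => /predU1P[<-|t0]; first exact: eigen_defect0.
have [M [w HM]] := C0_bounded semiS.
(* A bound on S uniform over [0, t]; absolute values are taken because M and w may have any sign. *)
pose C := `|M| * expR (`|w| * t).
have C0 : 0 <= C by rewrite mulr_ge0 ?expR_ge0.
have HC s g : 0 <= s <= t -> torus_L2 g -> L2norm (S s g) <= C * L2norm g.
  move=> /andP[s0 st] Lg; rewrite (le_trans (HM _ _ s0 Lg))// ler_wpM2r ?L2norm_ge0//.
  apply: (@le_trans _ _ (`|M| * expR (w * s))).
    by rewrite ler_wpM2r ?expR_ge0// ler_norm.
  rewrite ler_wpM2l// ler_expR (@le_trans _ _ (`|w| * s))//.
    by rewrite ler_wpM2r// ler_norm.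
  by rewrite ler_wpM2l.
have key e : 0 < e -> d t <= C * t * e.
  move=> e0; have [/= del del0 H] := eigen_step e0.
  (* Enough steps for each to be shorter than [del]; m steps of cost C (t/m) e add up to C t e. *)
  pose m := Num.bound (t / del); have mb : t / del < m%:R.
    by apply: archi_boundP; rewrite divr_ge0// ltW.
  have m0 : 0 < m%:R :> R by apply: lt_trans mb; rewrite divr_gt0.
  have h0 : 0 < t / m%:R by rewrite divr_gt0.
  have th : t = m%:R * (t / m%:R) by rewrite mulrCA mulfV ?mulr1// gt_eqF.
  have dh : d (t / m%:R) <= t / m%:R * e.
    apply: H => //=; rewrite /ball_/= sub0r normrN gtr0_norm//.
    by rewrite ltr_pdivrMr// mulrC -ltr_pdivrMr.
  rewrite {1}th (le_trans (eigen_iter (C := C) (ltW h0) C0 _))//.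
    move=> j jm g Lg; apply: HC => //; rewrite mulr_ge0 ?(ltW h0)//=.
    by rewrite [leRHS]th ler_wpM2r ?(ltW h0)// ler_nat ltnW.
  rewrite mulrCA -mulrA ler_wpM2l//.
  apply: le_trans (ler_wpM2l (ltW m0) dh) _.
  by rewrite mulrA -th.
apply/eqP; rewrite eq_le L2norm_ge0 andbT leNgt; apply/negP => dt0.
(* With e = d(t)/(2K) the bound C t e falls strictly below d(t). *)
pose K := C * t + 1; have K0 : 0 < K by rewrite ltr_wpDl// mulr_ge0// ltW.
have := key (d t / K / 2); rewrite !divr_gt0// => /(_ isT).
rewrite leNgt => /negP; apply.
rewrite mulrA ltr_pdivrMr// mulrA ltr_pdivrMr//.
by rewrite /K; have := mulr_ge0 C0 (ltW t0); nra.
Qed.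

End eigenfunction.
End semigroup.

(** * The Gaussian sum and the two heat traces *)

Section multi_index.
Variable n : nat.

(** Hilbert bases are indexed by nat, so the characters need an enumeration. The multi-indices are
    countable, and infinite because the modulus of the first coordinate already takes every
    value. *)
Lemma multi_index_enum : (0 < n)%N ->
  exists s : nat -> 'rV[int]_n, set_bij [set: nat] [set: 'rV[int]_n] s.
Proof.
move=> n0.
have : card_eq [set: 'rV[int]_n] [set: nat].
  apply/card_eqPle; split; first exact: countableP.
  apply/infiniteP => /(finite_image (fun m : 'rV[int]_n => absz (m 0 (Ordinal n0)))).
  rewrite (_ : image _ _ = [set: nat]); first exact: infinite_nat.
  by apply/seteqP; split => // k _; exists (const_mx (Posz k)) => //; rewrite mxE.
move=> /card_set_bijP[f [_ finj fsurj]].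
have /choice[s fs] k : exists m, f m = k by have [m _ <-] := fsurj k I; exists m.
have sf m : s (f m) = m by apply: finj; rewrite ?inE// fs.
exists s; split => //.
- by move=> a b _ _ /(congr1 f); rewrite !fs.
- by move=> m _; exists (f m).
Qed.

End multi_index.

(** * Finiteness of the Gaussian sum *)

Section gaussian.
Variables (R : realType) (t : R).
Hypothesis t0 : 0 < t.

Definition gauss n (m : 'rV[int]_n) : R := expR (- t * normsq R m).

Lemma gauss_prod n (m : 'rV[int]_n) :
  gauss m = \prod_(i < n) expR (- t * (m 0 i)%:~R ^+ 2).
Proof. by rewrite /gauss /normsq mulr_sumr expR_sum. Qed.

Lemma geometric_partial_le (q : R) K : 0 <= q < 1 ->
  \sum_(j < K) q ^+ j <= (1 - q)^-1.
Proof.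
move=> /andP[q0 q1]; rewrite -[leRHS]mul1r ler_pdivlMr ?subr_gt0//.
have -> : (\sum_(j < K) q ^+ j) * (1 - q) = 1 - q ^+ K.
  elim: K => [|K IH]; first by rewrite big_ord0 mul0r expr0 subrr.
  by rewrite big_ord_recr mulrDl IH exprS /=; ring.
by rewrite lerBlDr lerDl exprn_ge0.
Qed.

Let q := expR (- t).

Let q01 : 0 <= q < 1.
Proof. by rewrite expR_ge0/= -expR0 ltr_expR oppr_lt0. Qed.

(* Zero is enumerated twice, which is harmless for an upper bound. *)
Definition signed_ord B (p : bool * 'I_B) : int :=
  if p.1 then - (p.2 : nat)%:Z else (p.2 : nat)%:Z.

(** As j <= j^2, each of the two signs contributes at most a geometric series in q = exp(-t). *)
Lemma gauss_1d B : \sum_(p : bool * 'I_B) expR (- t * (signed_ord p)%:~R ^+ 2) <=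
  2 * (1 - q)^-1.
Proof.
rewrite -(pair_bigA _ (fun b j => expR (- t * (signed_ord (b, j))%:~R ^+ 2)))/=.
have H b : \sum_(j < B) expR (- t * (signed_ord (b, j))%:~R ^+ 2) <= (1 - q)^-1.
  apply: le_trans (geometric_partial_le B q01); apply: ler_sum => j _.
  have -> : (signed_ord (b, j))%:~R ^+ 2 = (j : nat)%:R ^+ 2 :> R.
    by rewrite /signed_ord; case: b => /=; rewrite ?mulrNz ?sqrrN -pmulrn.
  rewrite /q -expRM_natl ler_expR mulNr mulrN lerN2 mulrC ler_wpM2l ?(ltW t0)//.
  by rewrite -natrX ler_nat; case: (j : nat) => // k; rewrite leq_pmulr.
by rewrite big_bool /= mulr_natl mulr2n lerD.
Qed.

(* A finite set of multi-indices lies in a box, over which the sum is a product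
   of one-dimensional sums. *)
Lemma gauss_seq_le n (s : seq 'rV[int]_n) : uniq s ->
  \sum_(m <- s) gauss m <= (2 * (1 - q)^-1) ^+ n.
Proof.
move=> us.
pose B := (\max_(m <- s) \max_(i < n) absz (m 0%R i))%N.+1.
have mB m i : m \in s -> (absz (m 0%R i) < B)%N.
  move=> ms; rewrite ltnS.
  apply: (@leq_trans (\max_(i < n) absz (m 0%R i))%N).
    exact: (leq_bigmax (F := fun i => absz (m 0%R i)) i).
  exact: (leq_bigmax_seq (F := fun m : 'rV_n => (\max_(i < n) absz (m 0%R i))%N)).
(* Each m in s is coded by the signs and moduli of its entries; [psi] decodes, so [phi] is injective
   on s and the sum over s is part of the sum over the box. *)
pose phi (m : 'rV[int]_n) : {ffun 'I_n -> bool * 'I_B} :=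
  [ffun i => (m 0 i < 0, inord (absz (m 0 i)))].
pose psi (f : {ffun 'I_n -> bool * 'I_B}) : 'rV[int]_n := \row_i signed_ord (f i).
have phiK : {in s, cancel phi psi}.
  move=> m ms; apply/rowP => i; rewrite !mxE !ffunE /signed_ord /=.
  rewrite inordK ?mB//.
  by case: ltP => h; [rewrite ltz0_abs// opprK|rewrite gez0_abs].
have -> : \sum_(m <- s) gauss m = \sum_(f <- map phi s) gauss (psi f).
  by rewrite big_map big_seq [RHS]big_seq; apply: eq_bigr => m ms; rewrite phiK.
rewrite big_uniq/=; last by rewrite map_inj_in_uniq//; exact: can_in_inj phiK.
apply: (@le_trans _ _ (\sum_(f : {ffun 'I_n -> bool * 'I_B}) gauss (psi f))).
  rewrite [leRHS](bigID (mem (map phi s)))/= lerDl sumr_ge0// => f _.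
  exact: expR_ge0.
under eq_bigr do rewrite gauss_prod.
rewrite (eq_bigr (fun f : {ffun _ -> _} =>
  \prod_(i < n) expR (- t * (signed_ord (f i))%:~R ^+ 2))); last first.
  by move=> f _; apply: eq_bigr => i _; rewrite mxE.
rewrite -(bigA_distr_bigA (fun (i : 'I_n) p => expR (- t * (signed_ord p)%:~R ^+ 2))).
rewrite prodr_const card_ord lerXn2r ?nnegrE ?gauss_1d//.
- by rewrite sumr_ge0// => p _; exact: expR_ge0.
- by rewrite mulr_ge0// invr_ge0 subr_ge0; case/andP: q01 => _ /ltW.
Qed.

Lemma gauss_esum n : exists2 r : R, 0 <= r &
  (\esum_(m in [set: 'rV[int]_n]) (gauss m)%:E = r%:E)%E.
Proof.
set E := (\esum_(m in _) _)%E.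
have E0 : (0 <= E)%E by apply: esum_ge0 => m _; rewrite lee_fin expR_ge0.
have EC : (E <= ((2 * (1 - q)^-1) ^+ n)%:E)%E.
  (* The sum is a supremum over finite index sets, all under the same bound. *)
  apply: ge_ereal_sup => _ [A [fA _] <-].
  rewrite fsbig_finite//= sumEFin lee_fin.
  exact/gauss_seq_le/finmap.fset_uniq.
exists (fine E); first exact: fine_ge0.
by rewrite fineK// ge0_fin_numE// (le_lt_trans EC) ?ltry.
Qed.

End gaussian.

(** * The characters as a Hilbert basis and the trace on the torus *)

Section character_basis.
Variables (R : realType) (n : nat) (s : nat -> 'rV[int]_n).
Hypothesis s_bij : set_bij [set: nat] [set: 'rV[int]_n] s.
Local Notation X := (n.-tuple (measurableTypeR R)).
Local Notation e k := (@torus_char R n (s k)).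

Lemma trig_char_comb f : trig f ->
  exists M (c : nat -> R[i]), f = fun x : X => \sum_(i < M) c i * e i x.
Proof.
elim=> [m|a {}f g _ [M [c ->]] _ [M' [c' ->]]].
  have [_ _ /(_ m I)[k _ <-]] := s_bij.
  (* Only the last term, at the index k of m, is nonzero; its coefficient undoes the normalisation
     of the character. *)
  exists k.+1, (fun i => if i == k then (Num.sqrt (torus_mass R n))%:C%C else 0).
  apply/funext => x; rewrite big_ord_recr/= eqxx big1 ?add0r => [|i _].
    rewrite torus_charE mulrA -rmorphM mulfV ?mul1r//.
    by rewrite gt_eqF// sqrtr_gt0 torus_mass_gt0.
  by rewrite ltn_eqF ?mul0r.
have widen (N : nat) K (d : nat -> R[i]) (x : X) : (N <= K)%N ->
    \sum_(i < N) d i * e i x = \sum_(i < K) (if (i < N)%N then d i else 0) * e i x.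
  move=> NK; rewrite (big_ord_widen _ (fun i => d i * e i x) NK) big_mkcond/=.
  by apply: eq_bigr => i _; case: ifP => // _; rewrite mul0r.
exists (maxn M M'), (fun i => a * (if (i < M)%N then c i else 0) +
  (if (i < M')%N then c' i else 0)).
apply/funext => x; rewrite (widen M _ c x (leq_maxl M M')) (widen M' _ c' x (leq_maxr M M')).
by rewrite mulr_sumr -big_split/=; apply: eq_bigr => i _; rewrite mulrDl mulrA.
Qed.

Lemma hilbert_basis_char : hilbert_basis (fun k => e k).
Proof.
split=> [i|i j|f /dense_L2[_ Hf] r /Hf[p /trig_char_comb[M [c ->]] fp]].
- exact: L2_torus_char.
- rewrite ip_torus_char; congr (nat_of_bool _)%:R.
  apply/eqP/eqP => [|->//]; have [_ inj _] := s_bij.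
  by apply: inj; rewrite inE.
- by exists M, c.
Qed.

Lemma torus_trace (S : R -> (X -> R[i]) -> X -> R[i]) t (r : R) :
  is_torus_heat_semigroup S -> 0 <= t ->
  (\esum_(m in [set: 'rV[int]_n]) (gauss t m)%:E = r%:E)%E ->
  L2_trace_class (S t) /\ L2_trace (S t) = r%:C%C.
Proof.
move=> [semiS genS] t0 gr.
apply: (@L2_trace_diagonal _ _ _ _ (fun k => gauss t (s k)) _ hilbert_basis_char).
- exact: C0_operator.
- by move=> k; exact: expR_ge0.
- move=> k; have /genS genk := @torus_laplacian_char R n (s k).
  have ns0 : 0 <= normsq R (s k) by apply: sumr_ge0 => i _; rewrite sqr_ge0.
  have := eigen_semigroup semiS ns0 genk t0.
  by have -> : - normsq R (s k) * t = - t * normsq R (s k) by ring.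
- rewrite nneseries_esumT; last by move=> k; rewrite lee_fin expR_ge0.
  by rewrite -gr (reindex_esum [set: nat] _ s).
Qed.

End character_basis.

(** * The spectral trace on the Heisenberg side *)

Section heisenberg_trace.
Variables (R : realType) (N : nat) (Z : R[i]) (H : cstarAlgebra R).
Variables P Q : 'I_N -> H.
Hypothesis relPQ : heisenberg_relations Z P Q.

Lemma cs_mulx0 (x : H) : cs_mul x 0 = 0.
Proof.
by apply: (@addrI _ (cs_mul x 0)); rewrite -cs_mulDr !addr0.
Qed.

Lemma unitary_one : unitary (cs_one : H).
Proof.
have star1 : cs_star cs_one = cs_one :> H.
  by rewrite -[LHS]cs_mulx1 -[X in cs_mul _ X]cs_starK -cs_starM cs_mulx1 cs_starK.
by split; rewrite star1 cs_mul1x.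
Qed.

Lemma unitaryM (u v : H) : unitary u -> unitary v -> unitary (cs_mul u v).
Proof.
move=> [u1 u2] [v1 v2]; split; rewrite cs_starM.
  by rewrite -cs_mulA [cs_mul _ (cs_mul u v)]cs_mulA u1 cs_mul1x.
by rewrite -cs_mulA [cs_mul v _]cs_mulA v2 cs_mul1x.
Qed.

Lemma unitary_star (u : H) : unitary u -> unitary (cs_star u).
Proof. by move=> [u1 u2]; split; rewrite cs_starK. Qed.

Lemma unitary_neq0 (u : H) : unitary u -> u != 0.
Proof.
move=> [u1 _]; apply/eqP => u0; move: u1; rewrite u0 cs_mulx0 => /esym/eqP.
by rewrite (negPf (cs_one_neq0 _)).
Qed.

Lemma unitary_upow (u : H) m : unitary u -> unitary (upow u m).
Proof.
move=> uu; case: m => k; rewrite /upow.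
  by elim: k => [|k IH]; [exact: unitary_one|exact: unitaryM].
by elim: k.+1 => [|j IH]; [exact: unitary_one|apply: unitaryM => //; exact: unitary_star].
Qed.

Lemma heis_monomial_neq0 m : heis_monomial P Q m != 0.
Proof.
apply: unitary_neq0; apply: unitaryM.
- elim/big_ind: _ => [|u v|j _]; [exact: unitary_one|exact: unitaryM|].
  by apply: unitary_upow; exact: heis_unitaryP relPQ j.
- elim/big_ind: _ => [|u v|j _]; [exact: unitary_one|exact: unitaryM|].
  by apply: unitary_upow; exact: heis_unitaryQ relPQ j.
Qed.

(** Nonzero monomials determine the eigenvalue family, hence the value that [xget] selects. *)
Lemma spectral_traceE (F : H -> H) (lam : 'rV[int]_(N + N) -> R[i]) (tau : R[i]) :
  (forall m, F (heis_monomial P Q m) = lam m *: heis_monomial P Q m) ->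
  abs_summable lam -> csum lam = tau ->
  spectral_trace_class P Q F /\ spectral_trace P Q F = tau.
Proof.
move=> Flam slam clam.
have htau : has_spectral_trace P Q F tau by exists lam.
split; first by exists tau.
rewrite /spectral_trace; case: xgetP => [x _ [lam' [Flam' _ <-]]|/(_ tau)/(_ htau)//].
rewrite -clam; congr csum; apply/funext => m.
apply/eqP; rewrite -subr_eq0; have /eqP := Flam' m.
by rewrite Flam eq_sym -subr_eq0 -scalerBl scaler_eq0 (negPf (heis_monomial_neq0 m)) orbF.
Qed.

End heisenberg_trace.

(** * Uniqueness of heat coefficients *)

Section coefficients.
Variables (R : realType) (N : nat).
Implicit Types (h : R -> R[i]) (A B : nat -> R[i]).

Lemma heat_coefficients_ext h h' A : (forall t, 0 < t -> h t = h' t) ->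
  heat_coefficients N h A -> heat_coefficients N h' A.
Proof.
move=> hh' hA K; apply: cvg_trans (hA K); apply: near_eq_cvg.
by near=> t; rewrite hh'//; near: t; exact: nbhs_right_gt.
Unshelve. all: by end_near. Qed.

(** Strong induction: once the lower coefficients agree, (A_K - B_K) t^{K/2} is a difference of two
    remainders of order o(t^{K/2}). *)
Lemma heat_coefficients_unique h A B : heat_coefficients N h A ->
  heat_coefficients N h B -> forall k, A k = B k.
Proof.
move=> hA hB; elim/ltn_ind => K IH.
apply/eqP; rewrite -subr_eq0; apply/eqP/Normc.eq0_normc/eqP.
rewrite eq_le normc_ge0 andbT.
have cv := cvgD (hA K) (hB K); rewrite addr0 in cv.
apply: (cvgr_to_ge (cv _)); near=> t.
have t0 : 0 < t by near: t; exact: nbhs_right_gt.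
have sK0 : 0 < Num.sqrt t ^+ K by rewrite exprn_gt0// sqrtr_gt0.
rewrite /= -mulrDl ler_pdivlMr//.
pose F := ((4 * pi * t) ^+ N)%:C%C * h t.
pose SA := \sum_(k < K.+1) A k * (Num.sqrt t ^+ k)%:C%C.
pose SB := \sum_(k < K.+1) B k * (Num.sqrt t ^+ k)%:C%C.
rewrite -[leRHS]/(Normc.normc (F - SA) + Normc.normc (F - SB)).
have -> : Num.sqrt t ^+ K = Normc.normc (Num.sqrt t ^+ K)%:C%C.
  by rewrite /= expr0n addr0 sqrtr_sqr ger0_norm// ltW.
rewrite -Normc.normcM.
have -> : (A K - B K) * (Num.sqrt t ^+ K)%:C%C = - (F - SA) + (F - SB).
  rewrite opprB addrA subrK /SA /SB !big_ord_recr/= mulrBl.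
  rewrite (eq_bigr (fun k : 'I_K => B k * (Num.sqrt t ^+ k)%:C%C)); last by move=> i _; rewrite IH.
  by rewrite opprD addrACA subrr add0r.
by rewrite (le_trans (le_normcD _ _))// normc_opp.
Unshelve. all: by end_near. Qed.

End coefficients.

Theorem theorem6p2 (R : realType) (N : nat) (Z : R[i])
    (H : cstarAlgebra R) (P Q : 'I_N -> H)
    (T : R -> {linear H -> H})
    (S : R -> ((N + N).-tuple (measurableTypeR R) -> R[i]) ->
         (N + N).-tuple (measurableTypeR R) -> R[i]) :
  (0 < N)%N ->
  `|Z| = 1 ->
  is_heisenberg Z P Q ->
  is_heis_heat_semigroup P Q T ->
  is_torus_heat_semigroup S ->
  (forall t : R, 0 < t ->
     [/\ spectral_trace_class P Q (T t),
         L2_trace_class (S t),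
         heis_heat_trace P Q T t = spectral_trace P Q (T t) &
         spectral_trace P Q (T t) = L2_trace (S t)]) /\
  (forall A : nat -> R[i],
     heat_coefficients N (heis_heat_trace P Q T) A <->
     heat_coefficients N (torus_heat_trace S) A) /\
  (forall A B : nat -> R[i],
     heat_coefficients N (heis_heat_trace P Q T) A ->
     heat_coefficients N (torus_heat_trace S) B ->
     forall k : nat, A k = B k).
Proof.
move=> N0 _ [relPQ _ _] heatT heatS.
have [s s_bij] : exists s, set_bij [set: nat] [set: 'rV[int]_(N + N)] s.
  by apply: multi_index_enum; rewrite addn_gt0 N0.
have traces (t : R) : 0 < t ->
    [/\ spectral_trace_class P Q (T t), L2_trace_class (S t) &
        spectral_trace P Q (T t) = L2_trace (S t)].
  (* The Gaussian sum r is the common value of the two traces. *)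
  move=> t0; have [r r0 gr] := gauss_esum t0 (N + N).
  have [tcS trS] := torus_trace s_bij heatS (ltW t0) gr.
  have [_ Tmon] := heatT t (ltW t0).
  have [sg cg] := csum_ge0 (f := fun m => (gauss t m)%:C%C) (fun=> erefl)
    (fun m => expR_ge0 _) gr.
  have [tcT trT] := spectral_traceE relPQ Tmon sg cg.
  by split => //; rewrite trT trS.
have eq_tr t : 0 < t -> heis_heat_trace P Q T t = torus_heat_trace S t.
  by move=> /traces[].
split; first by move=> t /traces[].
have hST A : heat_coefficients N (heis_heat_trace P Q T) A <->
    heat_coefficients N (torus_heat_trace S) A.
  split; apply: heat_coefficients_ext => // t t0.
  by rewrite eq_tr.
split => // A B /hST hA hB; exact: heat_coefficients_unique hA hB.
Qed.
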